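(* Let $R$ be a unital ring and consider the sequence of general linear groups $$\mathrm{GL}_0(R)\hookrightarrow \mathrm{GL}_1(R)\hookrightarrow\dots\hookrightarrow\mathrm{GL}_n(R)\xrightarrow{\iota_n}\mathrm{GL}_{n+1}(R)\hookrightarrow\cdots .$$ Then the inclusion $\iota_n:\mathrm{GL}_n(R)\hookrightarrow\mathrm{GL}_{n+1}(R)$ induces an isomorphism $$H^q_{\mathrm b}(\mathrm{GL}_{n+1}(R);\mathbb R)\longrightarrow H^q_{\mathrm b}(\mathrm{GL}_n(R);\mathbb R)$$ whenever $q\le\frac{n-\mathrm{sr}(R)}{2}$, and an injection whenever $q\le\frac{n-\mathrm{sr}(R)}{2}+1$. Here $\mathrm{sr}(R)\in[1,\infty]$ denotes the Bass stable rank of $R$.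
   Context: All groups are considered as discrete groups. The bounded cohomology $H^q_{\mathrm b}(\Gamma;\mathbb R)$ of a discrete group $\Gamma$ is the cohomology of the complex of bounded real-valued simplicial cochains on the nerve of $\Gamma$ (the bounded cochains on the bar complex). The maps $\iota_n$ are the standard inclusions (extending an automorphism of $R^n$ by the identity on the additional standard basis vector), where $\mathrm{GL}_n(R)=\mathrm{Aut}_R(R^n)$. Bass stable rank: a vector $v\in R^l$ is unimodular if $\{v\}$ is a basis of a free direct summand of rank one of $R^l$. $R$ satisfies $(SR_l)$ if for every $l'\ge l$ and every unimodular column vector $(r_1,\dots,r_{l'})^T\in R^{l'}$ there are $t_1,\dots,t_{l'-1}\in R$ such that $(r_1+t_1r_{l'},\dots,r_{l'-1}+t_{l'-1}r_{l'})^T\in R^{l'-1}$ is unimodular. $\mathrm{sr}(R)$ is the smallest $l\ge1$ such that $R$ satisfies $(SR_{l+1})$, and $\infty$ if no such $l$ exists (in which case the statement is empty). *)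

(* Defs.v *)
From HB Require Import structures.
From mathcomp Require Import all_boot all_order all_algebra.
From mathcomp Require Import boolp classical_sets functions.
From mathcomp Require Import constructive_ereal reals.
From mathcomp Require Import zify.

Set Implicit Arguments.
Unset Strict Implicit.
Unset Printing Implicit Defensive.

Import Order.TTheory GRing.Theory Num.Theory.
Local Open Scope ring_scope.
Local Open Scope quotient_scope.

Section CochainComplexes.
Variable K : pzRingType.

Record cochain_complex := CochainComplex {
  cochains :> nat -> lmodType K;
  cdiff : forall q, {linear cochains q -> cochains q.+1};
  cdiffK : forall q x, cdiff q.+1 (cdiff q x) = 0
}.

Section Cohomology.
Variables (C : cochain_complex) (q : nat).

Definition cocycle : {pred C q} := [pred x | cdiff C q x == 0].

Lemma cocycle_submod : submod_closed cocycle.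
Proof.
split=> [|a x y]; rewrite !inE ?linear0 //.
by move=> /eqP zx /eqP zy; rewrite linearP zx zy scaler0 addr0.
Qed.

HB.instance Definition _ := GRing.isSubmodClosed.Build K (C q) cocycle
  cocycle_submod.

Record cocycles := Cocycle { cocycle_val : C q; _ : cocycle_val \in cocycle }.
HB.instance Definition _ := [isSub for cocycle_val].
HB.instance Definition _ := [Choice of cocycles by <:].
HB.instance Definition _ := [SubChoice_isSubZmodule of cocycles by <:].
HB.instance Definition _ := [SubZmodule_isSubLmodule of cocycles by <:].

End Cohomology.

(* In degree 0 the incoming differential is 0. *)
Definition is_coboundary (C : cochain_complex) (q : nat) : C q -> Prop :=
  match q with
  | 0 => fun x => x = 0
  | p.+1 => fun x => exists y : C p, x = cdiff C p y
  end.

Section Cohomology.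
Variables (C : cochain_complex) (q : nat).

Definition coboundary : {pred cocycles C q} :=
  [pred z | `[< @is_coboundary C q (val z) >]].

Lemma coboundary_submod : submod_closed coboundary.
Proof.
split=> [|a x y]; rewrite !inE.
  rewrite raddf0; case: q => [|p] //=.
  by exists 0; rewrite linear0.
have -> : val (a *: x + y) = a *: val x + val y by rewrite linearP.
move: (val x) (val y) => {x y}.
case: q => [|p] x y /=; first by move=> -> ->; rewrite scaler0 addr0.
move=> [u ->] [v ->]; by exists (a *: u + v); rewrite linearP.
Qed.

HB.instance Definition _ := GRing.isSubmodClosed.Build K (cocycles C q)
  coboundary coboundary_submod.

(* Quotient.quot carries only a Z-module structure for a general subgroup; the
   scalar action is added below. *)
Definition cohomology : Type := Quotient.quot coboundary.
HB.instance Definition _ := GRing.Zmodule.on cohomology.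

Definition coh_class (z : cocycles C q) : cohomology :=
  \pi_(Quotient.quot coboundary) z.

Lemma coh_classP (x : cohomology) : exists z, x = coh_class z.
Proof. by exists (repr (x : Quotient.quot _)); rewrite /coh_class reprK. Qed.

Lemma coh_class_eq y z : coh_class y = coh_class z <-> y - z \in coboundary.
Proof. by rewrite Quotient.idealrBE; split=> [/eqP|/eqP]. Qed.

Lemma coh_classD : {morph coh_class : y z / y + z}.
Proof. exact: Quotient.pi_add. Qed.

Definition coh_scale (a : K) (x : cohomology) : cohomology :=
  coh_class (a *: repr (x : Quotient.quot coboundary)).

Lemma coh_scale_class a z : coh_scale a (coh_class z) = coh_class (a *: z).
Proof.
apply/coh_class_eq; rewrite -scalerBr rpredZ //.
by apply/coh_class_eq; rewrite /coh_class reprK.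
Qed.

Lemma coh_scaleA a b x : coh_scale a (coh_scale b x) = coh_scale (a * b) x.
Proof. by have [z ->] := coh_classP x; rewrite !coh_scale_class scalerA. Qed.

Lemma coh_scale1 : left_id 1 coh_scale.
Proof.
by move=> x; have [z ->] := coh_classP x; rewrite coh_scale_class scale1r.
Qed.

Lemma coh_scaleDr : right_distributive coh_scale +%R.
Proof.
move=> a x y; have [z ->] := coh_classP x; have [w ->] := coh_classP y.
by rewrite !coh_scale_class -!coh_classD coh_scale_class scalerDr.
Qed.

Lemma coh_scaleDl x : {morph coh_scale^~ x : a b / a + b}.
Proof.
move=> a b; have [z ->] := coh_classP x.
by rewrite !coh_scale_class -coh_classD scalerDl.
Qed.

HB.instance Definition _ := GRing.Zmodule_isLmodule.Build K cohomology
  coh_scaleA coh_scale1 coh_scaleDr coh_scaleDl.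

Lemma coh_classZ a z : coh_class (a *: z) = a *: coh_class z.
Proof. by rewrite -coh_scale_class. Qed.

End Cohomology.

Record cochain_map (C D : cochain_complex) := CochainMap {
  cmap :> forall q, {linear C q -> D q};
  cmap_diff : forall q x, cmap q.+1 (cdiff C q x) = cdiff D q (cmap q x)
}.

Section CohomologyMap.
Variables (C D : cochain_complex) (f : cochain_map C D) (q : nat).

Lemma cmap_cocycle (z : cocycles C q) : f q (cocycle_val z) \in @cocycle D q.
Proof.
by case: z => z /=; rewrite !inE -cmap_diff => /eqP ->; rewrite linear0.
Qed.

Definition cocycle_map (z : cocycles C q) : cocycles D q :=
  Cocycle (cmap_cocycle z).

Lemma cocycle_map_coboundary z :
  z \in @coboundary C q -> cocycle_map z \in @coboundary D q.
Proof.
rewrite !inE /=; move: (cocycle_val z) => {}z; case: q z => [|p] z /=.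
  by move=> ->; rewrite linear0.
by case=> y ->; exists (f p y); rewrite cmap_diff.
Qed.

Lemma cocycle_map_linear : linear cocycle_map.
Proof. by move=> a x y; apply: val_inj; rewrite /= !linearP. Qed.

Definition cohomology_map (x : cohomology C q) : cohomology D q :=
  coh_class (cocycle_map (repr (x : Quotient.quot _))).

Lemma cohomology_map_class z :
  cohomology_map (coh_class z) = coh_class (cocycle_map z).
Proof.
apply/coh_class_eq.
have -> u v : cocycle_map u - cocycle_map v = cocycle_map (u - v).
  by apply: val_inj; rewrite /= !linearB.
by apply: cocycle_map_coboundary; apply/coh_class_eq; rewrite /coh_class reprK.
Qed.

Lemma cohomology_map_linear : linear cohomology_map.
Proof.
move=> a x y; have [z ->] := coh_classP x; have [w ->] := coh_classP y.
rewrite -coh_classZ -coh_classD !cohomology_map_class cocycle_map_linear.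
by rewrite coh_classD coh_classZ.
Qed.

HB.instance Definition _ := GRing.isLinear.Build K (cohomology C q)
  (cohomology D q) *:%R cohomology_map cohomology_map_linear.

End CohomologyMap.
End CochainComplexes.

Section BoundedBarComplex.
Variable K : realType.

(* The q-simplex (g_1, ..., g_q) of the nerve is a function 'I_q -> G with
   0-based indices.  Face i drops g_1 for i = 0, drops g_(q+1) for i = q+1, and
   multiplies g_i by g_(i+1) for 0 < i <= q; it is only used for i <= q+1. *)
Definition nerve_face (G : groupType) (q i : nat) (g : 'I_q.+1 -> G) :
    'I_q -> G :=
  fun j => if (j.+1 < i)%N then g (widen_ord (leqnSn q) j)
           else if j.+1 == i
                then (g (widen_ord (leqnSn q) j) * g (lift ord0 j))%g
                else g (lift ord0 j).

Lemma nerve_faceK (G : groupType) (q i k : nat) (g : 'I_q.+2 -> G) :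
  (i < k)%N ->
  nerve_face i (nerve_face k g) = nerve_face k.-1 (nerve_face i g).
Proof.
move=> lik; apply/funext => j; rewrite /nerve_face /= /bump /= !add1n.
have -> : widen_ord (leqnSn q.+1) (lift ord0 j) =
          lift ord0 (widen_ord (leqnSn q) j) by apply: val_inj.
move: (g _) (g _) (g _) => x y z.
do !case: ifP => ?; rewrite ?mulgA //; exfalso; lia.
Qed.

Definition bounded_cochain (G : groupType) (q : nat) :
    {pred ('I_q -> G) -> K^o} :=
  [pred f | `[< exists M : K, forall g, `|f g| <= M >]].

Arguments bounded_cochain : clear implicits.

Lemma bounded_cochain_submod G q : submod_closed (bounded_cochain G q).
Proof.
split=> [|a f h]; rewrite !inE; first by exists 0 => g; rewrite normr0.
move=> [M fM] [N hN]; exists (`|a| * M + N) => g.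
rewrite (le_trans (ler_normD _ _)) // lerD // normrM.
by rewrite ler_wpM2l.
Qed.

HB.instance Definition _ (G : groupType) (q : nat) :=
  GRing.isSubmodClosed.Build K (('I_q -> G) -> K^o) (bounded_cochain G q)
    (bounded_cochain_submod G q).

Record bcochain (G : groupType) (q : nat) := BCochain {
  bcochain_val :> ('I_q -> G) -> K^o;
  _ : bcochain_val \in bounded_cochain G q
}.

Section Instances.
Variables (G : groupType) (q : nat).
HB.instance Definition _ := [isSub for @bcochain_val G q].
HB.instance Definition _ := [Choice of bcochain G q by <:].
HB.instance Definition _ := [SubChoice_isSubZmodule of bcochain G q by <:].
HB.instance Definition _ := [SubZmodule_isSubLmodule of bcochain G q by <:].
End Instances.

Lemma bcochainP G q (f : bcochain G q) :
  exists2 M : K, 0 <= M & forall g, `|f g| <= M.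
Proof.
case: f => f /=; rewrite inE => -[M fM]; exists M => //.
exact: le_trans (normr_ge0 _) (fM (fun=> 1%g)).
Qed.

Section Differential.
Variables (G : groupType) (q : nat).

Definition bar_diff_fun (f : ('I_q -> G) -> K^o) : ('I_q.+1 -> G) -> K^o :=
  fun g => \sum_(i < q.+2) (-1) ^+ i * f (nerve_face i g).

Lemma bar_diff_bounded (f : bcochain G q) :
  bar_diff_fun f \in bounded_cochain G q.+1.
Proof.
have [M M0 fM] := bcochainP f; rewrite inE; exists (\sum_(i < q.+2) M) => g.
rewrite (le_trans (ler_norm_sum _ _ _)) // ler_sum // => i _.
by rewrite normrM normrX normrN1 expr1n mul1r.
Qed.

Definition bar_diff (f : bcochain G q) : bcochain G q.+1 :=
  BCochain (bar_diff_bounded f).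

Lemma bar_diff_linear : linear bar_diff.
Proof.
move=> a f h; apply: val_inj; apply/funext => g /=.
rewrite /bar_diff_fun -[RHS]/(a * _ + _) mulr_sumr -big_split /=.
by apply: eq_bigr => i _; rewrite -[X in _ * X]/(a * _ + _) mulrDr mulrCA.
Qed.

HB.instance Definition _ := GRing.isLinear.Build K (bcochain G q)
  (bcochain G q.+1) *:%R bar_diff bar_diff_linear.

End Differential.

Lemma sum_face_cancel (V : zmodType) (n : nat) (F : nat -> nat -> V) :
  (forall i k, (i < k)%N -> F k i = - F i k.-1) ->
  \sum_(k < n.+1) \sum_(i < n) F k i = 0.
Proof.
move=> FN.
have -> : \sum_(k < n.+1) \sum_(i < n) F k i =
    \sum_(k < n.+1) \sum_(i < n | (i < k)%N) F k i +
    \sum_(k < n.+1) \sum_(i < n | ~~ (i < k)%N) F k i.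
  rewrite -big_split /=; apply: eq_bigr => k _.
  by rewrite (bigID (fun i : 'I_n => (i < k)%N)).
rewrite big_ord_recl big1 // add0r [X in _ + X]big_ord_recr /=.
rewrite [X in _ + (_ + X)]big1 ?addr0; last by move=> i; rewrite ltn_ord.
rewrite [X in _ + X](exchange_big_dep predT) //= -big_split big1 //= => k _.
rewrite (eq_bigl (fun i : 'I_n => (i <= k)%N)); last by move=> i; rewrite ltnS.
rewrite [X in _ + X](eq_bigl (fun i : 'I_n => (i <= k)%N)); last first.
  by move=> i; rewrite -leqNgt.
rewrite -big_split big1 //= => i ik.
by rewrite FN ?addNr // /bump ltnS.
Qed.

Lemma bar_diffK G q (f : bcochain G q) : bar_diff (bar_diff f) = 0.
Proof.
apply: val_inj; apply/funext => g /=; rewrite /bar_diff_fun.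
under eq_bigr do rewrite mulr_sumr.
rewrite (@sum_face_cancel _ _ (fun k i =>
  (-1) ^+ k * ((-1) ^+ i * f (nerve_face i (nerve_face k g))))) //.
move=> i [|k] // ik; rewrite nerve_faceK //= exprS.
by rewrite mulN1r mulNr mulrCA.
Qed.

Definition bounded_bar (G : groupType) : cochain_complex K :=
  @CochainComplex K (bcochain G) (fun q => @bar_diff G q) (@bar_diffK G).

Definition bounded_cohomology (G : groupType) (q : nat) : lmodType K :=
  cohomology (bounded_bar G) q.

Section Functoriality.
Variables (G H : groupType) (phi : {multiplicative G -> H}).

Section Degree.
Variable q : nat.

Lemma bar_pullback_bounded (f : bcochain H q) :
  (fun g => f (phi \o g)) \in bounded_cochain G q.
Proof. by have [M _ fM] := bcochainP f; rewrite inE; exists M => g. Qed.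

Definition bar_pullback (f : bcochain H q) : bcochain G q :=
  BCochain (bar_pullback_bounded f).

Lemma bar_pullback_linear : linear bar_pullback.
Proof. by move=> a f h; apply: val_inj. Qed.

HB.instance Definition _ := GRing.isLinear.Build K (bcochain H q)
  (bcochain G q) *:%R bar_pullback bar_pullback_linear.

End Degree.

Lemma bar_pullback_diff q (f : bcochain H q) :
  bar_pullback (bar_diff f) = bar_diff (bar_pullback f).
Proof.
apply: val_inj; apply/funext => g; apply: eq_bigr => i _ /=.
congr (_ * f _); apply/funext => j; rewrite /nerve_face /=.
by do !case: ifP => ?; rewrite ?gmulfM.
Qed.

Definition bounded_bar_map : cochain_map (bounded_bar H) (bounded_bar G) :=
  @CochainMap K (bounded_bar H) (bounded_bar G)
    (fun q => bar_pullback (q := q)) bar_pullback_diff.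

Definition bounded_cohomology_map (q : nat) :
    {linear bounded_cohomology H q -> bounded_cohomology G q} :=
  cohomology_map bounded_bar_map (q := q).

End Functoriality.
End BoundedBarComplex.

(* R^n is the right R-module 'cV[R]_n, with v * a written v *m a%:M: this is the
   side for which automorphisms are left multiplications by matrices and the
   operations r_i + t_i * r_l of the stable range condition are automorphisms. *)
Section ColumnModules.
Variable R : pzRingType.

Definition right_linear (m n : nat) (f : 'cV[R]_m -> 'cV[R]_n) : Prop :=
  (forall u v, f (u + v) = f u + f v) /\
  (forall u (a : R), f (u *m a%:M) = f u *m a%:M).

Definition right_submodule (n : nat) (W : set 'cV[R]_n) : Prop :=
  [/\ W 0, forall u v, W u -> W v -> W (u + v) &
      forall u (a : R), W u -> W (u *m a%:M)].

Definition direct_summand (n : nat) (N : set 'cV[R]_n) : Prop :=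
  right_submodule N /\
  exists W : set 'cV[R]_n,
    [/\ right_submodule W,
        forall x, exists u w, [/\ N u, W w & x = u + w] &
        forall x, N x -> W x -> x = 0].

Definition unimodular (l : nat) (v : 'cV[R]_l) : Prop :=
  (forall a : R, v *m a%:M = 0 -> a = 0) /\
  direct_summand [set v *m a%:M | a in [set: R]].

(* Here l' = m + 1, so that lshift 1 i are the first l' - 1 indices and
   rshift m ord0 is the last one. *)
Definition SR (l : nat) : Prop :=
  forall m : nat, (l <= m + 1)%N ->
  forall r : 'cV[R]_(m + 1), unimodular r ->
  exists t : 'I_m -> R,
    unimodular (\col_(i < m) (r (lshift 1 i) 0 + t i * r (rshift m ord0) 0)).

Definition stable_rank : \bar rat :=
  match pselect (exists l, (1 <= l)%N && `[< SR l.+1 >]) with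
  | left ex => (ex_minn ex)%:R%:E
  | right _ => +oo%E
  end.

Record GL (n : nat) := MkGL {
  GL_fun :> 'cV[R]_n -> 'cV[R]_n;
  GL_linear : right_linear GL_fun;
  GL_bij : bijective GL_fun
}.

HB.instance Definition _ n := gen_eqMixin (GL n).
HB.instance Definition _ n := gen_choiceMixin (GL n).

Lemma GL_ext n (f g : GL n) : f =1 g -> f = g.
Proof.
case: f g => f fl fb [g gl gb] /= /funext fg.
by case: _ / fg in gl gb *; congr MkGL; exact: Prop_irrelevance.
Qed.

Section GLGroup.
Variable n : nat.

Definition GL_one : GL n.
Proof. by exists id => //; exists id. Defined.

Definition GL_mul (f g : GL n) : GL n.
Proof.
exists (f \o g); last exact: bij_comp (GL_bij f) (GL_bij g).
have [fD fZ] := GL_linear f; have [gD gZ] := GL_linear g.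
by split=> [u v|u a]; rewrite /= ?gD ?fD // gZ fZ.
Defined.

Lemma GL_inv_subproof (f : GL n) : {g : GL n | cancel f g /\ cancel g f}.
Proof.
apply: cid; have [g fK gK] := GL_bij f; have [fD fZ] := GL_linear f.
have gl : right_linear g.
  by split=> [u v|u a]; apply: (can_inj fK); rewrite ?fD ?fZ !gK.
have gb : bijective g by exists f.
by exists (MkGL gl gb).
Qed.

Definition GL_inv (f : GL n) : GL n := sval (GL_inv_subproof f).

Lemma GL_mulA : associative GL_mul.
Proof. by move=> f g h; apply: GL_ext. Qed.

Lemma GL_mul1 : left_id GL_one GL_mul.
Proof. by move=> f; apply: GL_ext. Qed.

Lemma GL_mulr1 : right_id GL_one GL_mul.
Proof. by move=> f; apply: GL_ext. Qed.

Lemma GL_mulV : left_inverse GL_one GL_inv GL_mul.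
Proof.
move=> f; apply: GL_ext => x.
by have [fK _] := svalP (GL_inv_subproof f); exact: fK.
Qed.

Lemma GL_mulrV : right_inverse GL_one GL_inv GL_mul.
Proof.
move=> f; apply: GL_ext => x.
by have [_ gK] := svalP (GL_inv_subproof f); exact: gK.
Qed.

HB.instance Definition _ := isGroup.Build (GL n)
  GL_mulA GL_mul1 GL_mulr1 GL_mulV GL_mulrV.

End GLGroup.

Section GLInclusion.
Variable n : nat.

(* R^(n+1) is R^n followed by one more coordinate, which is left fixed. *)
Definition GL_incl_fun (f : GL n) (x : 'cV[R]_(n + 1)) : 'cV[R]_(n + 1) :=
  col_mx (f (usubmx x)) (dsubmx x).

Lemma GL_incl_linear (f : GL n) : right_linear (GL_incl_fun f).
Proof.
have [fD fZ] := GL_linear f; rewrite /GL_incl_fun.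
split=> [u v|u a]; first by rewrite !linearD /= fD -add_col_mx.
by rewrite -{1 2}[u]vsubmxK mul_col_mx col_mxKu col_mxKd fZ mul_col_mx.
Qed.

Lemma GL_incl_bij (f : GL n) : bijective (GL_incl_fun f).
Proof.
have [g fK gK] := GL_bij f.
exists (fun x => col_mx (g (usubmx x)) (dsubmx x)) => x;
  by rewrite /GL_incl_fun col_mxKu col_mxKd ?fK ?gK vsubmxK.
Qed.

Definition GL_incl (f : GL n) : GL (n + 1) :=
  MkGL (GL_incl_linear f) (GL_incl_bij f).

Lemma GL_inclM : {morph GL_incl : f g / (f * g)%g}.
Proof.
move=> f g; apply: GL_ext => x /=.
by rewrite /GL_incl_fun col_mxKu col_mxKd.
Qed.

HB.instance Definition _ :=
  isMultiplicative.Build (GL n) (GL (n + 1)) GL_incl GL_inclM.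

End GLInclusion.
End ColumnModules.

(* Main.v *)
Require Import Defs.
From mathcomp Require Import all_boot all_order all_algebra.
From mathcomp Require Import boolp classical_sets functions filter.
From mathcomp Require Import constructive_ereal reals.
From mathcomp Require Import zify ring lra.
Set Implicit Arguments.
Unset Strict Implicit.
Unset Printing Implicit Defensive.
Import Order.TTheory GRing.Theory Num.Theory.
Local Open Scope ring_scope.

(** The general linear group [G] of [R^(n+1)] acts on the partial bases of
    [R^(n+1)], and bounded cohomology of [G] is compared with that of the
    stabilizer of one vector through the double complex of bounded invariant
    functions of a list of group elements and a partial basis, alternating in the
    latter ([bicochain]).  It is exact enough in both directions.

    Rows.  With the group elements fixed, one gets the complex of bounded
    alternating cochains on partial bases.  It is exact up to degree [i] if
    [n + 1 >= sr(R) + 1 + 2 i] ([unimodular_exact]).  The general tool is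
    [link_exact]: a complex is exact if its cocycles bound on the simplices in
    some set [X] of vertices and the links in [X] of the simplices outside [X]
    are exact.
    It is applied with [X] the vertices in a free submodule of corank one, which
    the stable range condition provides in a position that makes the links
    isomorphic to links of smaller rank ([split_off], [link_in_proj]).

    Columns.  With at least two vectors [x, y, ...] in the partial basis, the
    column is exact ([column_exact]): some group element [c] exchanges [x] and
    [y] and fixes the other vectors, so an alternating cochain changes sign under
    the action of [c].  If [c] could be chosen equivariantly, this action would
    be homotopic to the identity and the cohomology would vanish, since [2] is
    invertible.  The possible reflections [c] form a torsor under an abelian
    group of shears, and averaging over this group with an invariant mean
    ([invariant_mean]) replaces the equivariant choice.

    So only the columns without vectors and with one vector matter: by [zigzag],
    the former maps isomorphically to the latter in the range where the rows are
    exact.  The group acts transitively on unimodular vectors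
    ([transitive_unimodular]), hence the column with one vector computes the
    bounded cohomology of the stabilizer of the last basis vector.  The
    stabilizer is an extension of [GL_n] by an abelian group of shears, and by
    averaging over these it has the bounded cohomology of [GL_n]
    ([bounds_on_stabilizer]).  For a class of degree [q], injectivity needs the
    rows up to degree [q - 1] and surjectivity up to degree [q], which gives the
    two ranges.  Since the cochains are alternating and real, the groups
    [GL_m] with [m < n] never enter. *)

(** * Cochains as functions on lists *)

Section ListCochains.
Variables (K : realType) (V : Type).
Implicit Types (f g : seq V -> K) (phi : V -> seq V -> K) (s t : seq V).

Fixpoint dsum phi s : K :=
  if s is x :: u then phi x u - dsum (fun y w => phi y (x :: w)) u else 0.

Definition cobd f : seq V -> K := dsum (fun=> f).

Definition slice (x : V) f : seq V -> K := fun s => f (x :: s).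

(** Prepending [x] is a contracting homotopy for the coboundary; most arguments
    on lists below are inductions driven by this identity. *)
Lemma cobd_cons f x s : cobd f (x :: s) = f s - cobd (slice x f) s.
Proof. by []. Qed.

Lemma eq_dsum phi psi s : (forall x u, phi x u = psi x u) ->
  dsum phi s = dsum psi s.
Proof. by elim: s phi psi => //= x s IH phi psi e; rewrite e; congr (_ - _); exact: IH. Qed.

Lemma eq_cobd f g s : f =1 g -> cobd f s = cobd g s.
Proof. by move=> e; exact: eq_dsum. Qed.

Lemma eq_dsum_in phi psi s :
  (forall x u, (size u).+1 = size s -> phi x u = psi x u) ->
  dsum phi s = dsum psi s.
Proof.
elim: s phi psi => //= x s IH phi psi e; rewrite e //; congr (_ - _).
by apply: IH => y u eu; apply: e => /=; rewrite eu.
Qed.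

Lemma eq_cobd_size f g s :
  (forall u, (size u).+1 = size s -> f u = g u) -> cobd f s = cobd g s.
Proof. by move=> e; apply: eq_dsum_in => _; exact: e. Qed.

Lemma dsumD phi psi s :
  dsum (fun x u => phi x u + psi x u) s = dsum phi s + dsum psi s.
Proof.
elim: s phi psi => /= [|x s IH] phi psi; first by rewrite addr0.
by rewrite IH; ring.
Qed.

Lemma dsumZ a phi s : dsum (fun x u => a * phi x u) s = a * dsum phi s.
Proof.
elim: s phi => /= [|x s IH] phi; first by rewrite mulr0.
by rewrite IH; ring.
Qed.

Lemma dsumB phi psi s :
  dsum (fun x u => phi x u - psi x u) s = dsum phi s - dsum psi s.
Proof.
rewrite -mulN1r -dsumZ -dsumD; apply: eq_dsum => x u; ring.
Qed.

Lemma cobdD f g s : cobd (fun u => f u + g u) s = cobd f s + cobd g s.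
Proof. exact: dsumD. Qed.

Lemma cobdB f g s : cobd (fun u => f u - g u) s = cobd f s - cobd g s.
Proof. exact: dsumB. Qed.

Lemma cobdZ a f s : cobd (fun u => a * f u) s = a * cobd f s.
Proof. exact: dsumZ. Qed.

Lemma cobd0 s : cobd (fun=> 0) s = 0.
Proof. by rewrite -[RHS](mul0r (cobd (fun=> 0) s)) -cobdZ; apply: eq_cobd => u; rewrite mul0r. Qed.

Lemma cobdE f s :
  cobd f s = \sum_(i < size s) (-1) ^+ i * f (take i s ++ drop i.+1 s).
Proof.
elim: s f => [|x s IH] f; first by rewrite big_ord0.
rewrite cobd_cons IH /= big_ord_recl /= expr0 mul1r drop0; congr (_ + _).
rewrite -sumrN; apply: eq_bigr => i _.
by rewrite /bump /= add1n exprS /slice; ring.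
Qed.

Definition down_closed (P : seq V -> Prop) :=
  forall s1 x s2, P (s1 ++ x :: s2) -> P (s1 ++ s2).

Lemma down_closed_del P s i : down_closed P -> P s -> (i < size s)%N ->
  P (take i s ++ drop i.+1 s).
Proof.
case: s => [|x0 s'] // dP; set s := x0 :: s' => Ps lti.
by apply: (dP _ (nth x0 s i)); rewrite -drop_nth // cat_take_drop.
Qed.

Lemma size_del s i : (i < size s)%N ->
  (size (take i s ++ drop i.+1 s)).+1 = size s.
Proof. move=> lti; rewrite size_cat size_take size_drop lti; lia. Qed.

Lemma eq_cobd_in P f g s : down_closed P -> P s ->
  (forall u, P u -> (size u).+1 = size s -> f u = g u) -> cobd f s = cobd g s.
Proof.
move=> dP Ps e; rewrite !cobdE; apply: eq_bigr => i _; congr (_ * _).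
by apply: e; [exact: down_closed_del | exact: size_del].
Qed.

Lemma cobd_bound P f s M : down_closed P -> P s ->
  (forall u, P u -> (size u).+1 = size s -> `|f u| <= M) ->
  `|cobd f s| <= (size s)%:R * M.
Proof.
move=> dP Ps e; rewrite cobdE (le_trans (ler_norm_sum _ _ _)) //.
have -> : (size s)%:R * M = \sum_(i < size s) M.
  by rewrite sumr_const card_ord mulr_natl.
apply: ler_sum => i _; rewrite normrM normrX normrN1 expr1n mul1r.
by apply: e; [exact: down_closed_del | exact: size_del].
Qed.

(** The deletion sums anticommute because deleting two entries in either order
    gives the same list with opposite signs.  When [phi] ignores the deleted
    entry this says that the coboundary squares to zero. *)
Lemma cobd_dsum phi s : cobd (dsum phi) s = - dsum (fun x => cobd (phi x)) s.
Proof.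
elim: s phi => [|x s IH] phi; first by rewrite /= oppr0.
rewrite cobd_cons.
have -> : cobd (slice x (dsum phi)) s =
    cobd (phi x) s - cobd (dsum (fun y u => phi y (x :: u))) s.
  by rewrite -cobdB.
rewrite IH /=.
have -> : dsum (fun y w => cobd (phi y) (x :: w)) s =
   dsum phi s - dsum (fun y => cobd (fun u => phi y (x :: u))) s.
  by rewrite -dsumB.
ring.
Qed.

Lemma cobdK f s : cobd (cobd f) s = 0.
Proof. by have := cobd_dsum (fun=> f) s; rewrite -/(cobd f) -/(cobd (cobd f)); lra. Qed.

Definition alternating f :=
  forall s1 x y s2, f (s1 ++ x :: y :: s2) = - f (s1 ++ y :: x :: s2).

Lemma alternating_slice x f : alternating f -> alternating (slice x f).
Proof. by move=> af s1 y z s2; exact: (af (x :: s1)). Qed.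

Lemma dsum_swap phi s1 x y s2 :
  (forall z u1 u2, (size u1 + size u2).+1 = (size s1 + size s2)%N ->
    phi z (u1 ++ [:: x, y & u2]) = - phi z (u1 ++ [:: y, x & u2])) ->
  dsum phi (s1 ++ [:: x, y & s2]) = - dsum phi (s1 ++ [:: y, x & s2]).
Proof.
elim: s1 phi => [|z s1 IH] phi aphi /=.
  have -> : dsum (fun z w => phi z [:: x, y & w]) s2 =
     - dsum (fun z w => phi z [:: y, x & w]) s2.
    rewrite -mulN1r -dsumZ; apply: eq_dsum_in => z u eu.
    by rewrite (aphi z [::]) ?mulN1r.
  ring.
rewrite aphi // IH ?opprD // => u v w e.
by apply: (aphi _ (_ :: _)); rewrite /= !addSn e.
Qed.

Lemma alternating_dsum phi :
  (forall x, alternating (phi x)) -> alternating (dsum phi).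
Proof. by move=> aphi s1 x y s2; apply: dsum_swap => z u1 u2 _; exact: aphi. Qed.

Lemma alternating_cobd f : alternating f -> alternating (cobd f).
Proof. by move=> af; exact: alternating_dsum. Qed.

Lemma alternatingD f g :
  alternating f -> alternating g -> alternating (fun s => f s + g s).
Proof. by move=> af ag s1 x y s2; rewrite af ag opprD. Qed.

Lemma alternatingZ a f : alternating f -> alternating (fun s => a * f s).
Proof. by move=> af s1 x y s2; rewrite af mulrN. Qed.

(** Antisymmetrization.  The recursion on the entry that is moved to the front,
    instead of a sum over permutations, makes it an iterated deletion sum. *)
Fixpoint alt_rec n f s : K :=
  if n is m.+1 then n%:R^-1 * dsum (fun x => alt_rec m (slice x f)) s
  else f s.

Definition alt f s := alt_rec (size s) f s.

Lemma altE f s :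
  (size s)%:R * alt f s = dsum (fun x => alt (slice x f)) s.
Proof.
case: s => [|x s]; first by rewrite mul0r.
have -> : alt f (x :: s) = (size s).+1%:R^-1 *
    dsum (fun y => alt_rec (size s) (slice y f)) (x :: s) by [].
rewrite mulrA mulfV ?mul1r ?pnatr_eq0 //.
by apply: eq_dsum_in => y u [eu]; rewrite /alt eu.
Qed.

Lemma alt_cons f x s :
  alt f (x :: s) = (size s).+1%:R^-1 *
    dsum (fun x => alt (slice x f)) (x :: s).
Proof. by rewrite -altE mulrA mulVf ?mul1r ?pnatr_eq0. Qed.

Lemma eq_alt f g s : f =1 g -> alt f s = alt g s.
Proof. by move=> /funext->. Qed.

Lemma altD f g s : alt (fun u => f u + g u) s = alt f s + alt g s.
Proof.
rewrite /alt; move: (size s) => n; elim: n f g s => //= n IH f g s.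
rewrite -mulrDr -dsumD; congr (_ * _); apply: eq_dsum => x u.
exact: (IH (slice x f)).
Qed.

Lemma altZ a f s : alt (fun u => a * f u) s = a * alt f s.
Proof.
rewrite /alt; move: (size s) => n; elim: n f s => //= n IH f s.
rewrite [RHS]mulrCA -(dsumZ a); congr (_ * _); apply: eq_dsum => x u.
exact: (IH (slice x f)).
Qed.

Lemma altB f g s : alt (fun u => f u - g u) s = alt f s - alt g s.
Proof.
rewrite -mulN1r -altZ -altD; apply: eq_alt => u; ring.
Qed.

Lemma natf_inj n (a b : K) : n.+1%:R * a = n.+1%:R * b -> a = b.
Proof. by apply: mulfI; rewrite pnatr_eq0. Qed.

Lemma alternating_alt f : alternating (alt f).
Proof.
move=> s1 x y s2; have [n] := ubnP (size s1 + size s2).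
elim: n f s1 s2 => // n IH f s1 s2 lts.
have sE a b : size (s1 ++ [:: a, b & s2]) = (size s1 + size s2).+2.
  by rewrite size_cat /= !addnS.
apply: (@natf_inj (size s1 + size s2).+1).
rewrite mulrN -{1}(sE x y) -(sE y x) !altE.
by apply: dsum_swap => z u1 u2 eu; apply: IH; lia.
Qed.

Lemma alternating_insert f s : alternating f ->
  dsum (fun x => slice x f) s = (size s)%:R * f s.
Proof.
elim: s f => [|x s IH] f af; first by rewrite mul0r.
have -> : dsum (fun x => slice x f) (x :: s) =
    f (x :: s) + dsum (fun y => slice y (slice x f)) s.
  rewrite /= -[X in _ - X]opprK opprK; congr (_ + _).
  rewrite -mulN1r -dsumZ; apply: eq_dsum => y u.
  by rewrite /slice (af [::]) mulN1r opprK.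
rewrite IH; last exact: alternating_slice.
by rewrite /= -natr1 mulrDl mul1r addrC.
Qed.

Lemma alt_id f s : alternating f -> alt f s = f s.
Proof.
have [n] := ubnP (size s); elim: n f s => // n IH f [|x s] // lts af.
apply: (@natf_inj (size s)); rewrite -[(size s).+1]/(size (x :: s)).
rewrite -(alternating_insert (x :: s) af) (altE f (x :: s)).
apply: eq_dsum_in => y u [eu]; apply: IH; first by rewrite eu.
exact: alternating_slice.
Qed.

(** This is the anticommutation of deletion sums: [n] copies of the coboundary
    come from the [n] entries that can be moved to the front after a deletion. *)
Lemma cobd_alt f s : cobd (alt f) s = alt (cobd f) s.
Proof.
have [n] := ubnP (size s); elim: n f s => // n IH f [|x s] // lts.
apply: (@natf_inj (size s)); rewrite -[(size s).+1]/(size (x :: s)).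
rewrite [RHS](altE (cobd f) (x :: s)).
have -> : dsum (fun y => alt (slice y (cobd f))) (x :: s) =
    dsum (fun y u => alt f u - cobd (alt (slice y f)) u) (x :: s).
  apply: eq_dsum_in => y u [eu]; rewrite IH ?eu // -altB.
  exact: eq_alt.
rewrite dsumB -/(cobd (alt f)).
have -> : dsum (fun y => cobd (alt (slice y f))) (x :: s) =
     - ((size s)%:R * cobd (alt f) (x :: s)).
  rewrite -[LHS]opprK -cobd_dsum -cobdZ; congr (- _).
  by apply: eq_cobd_size => u [eu]; rewrite -altE eu.
by rewrite -natr1; ring.
Qed.

End ListCochains.

Section AltBound.
Variables (K : realType) (V : eqType).
Implicit Types (f : seq V -> K) (s t : seq V).

Lemma dsum_perm_bound (phi : V -> seq V -> K) s M :
  (forall x u, perm_eq (x :: u) s -> `|phi x u| <= M) ->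
  `|dsum phi s| <= (size s)%:R * M.
Proof.
elim: s phi => [|x s IH] phi b /=; first by rewrite normr0 mul0r.
rewrite (le_trans (ler_normB _ _)) // -natr1 mulrDl mul1r addrC lerD //.
  apply: IH => y u p; apply: b.
  by rewrite -[_ :: _ :: _]/([:: y] ++ [:: x] ++ u) perm_catCA /= perm_cons.
exact: b.
Qed.

Lemma alt_bound f s M :
  (forall u, perm_eq u s -> `|f u| <= M) -> `|alt f s| <= M.
Proof.
have [n] := ubnP (size s); elim: n f s => // n IH f [|x s] // lts b.
  exact: b.
rewrite alt_cons normrM ger0_norm ?invr_ge0 // ler_pdivrMl //.
apply: (@dsum_perm_bound _ (x :: s)) => y u p; apply: IH.
  by move/perm_size: p => [->].
move=> v pv; apply: b; apply: perm_trans p; by rewrite perm_cons.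
Qed.

End AltBound.

Section Naturality.
Variables (K : realType) (V W : Type) (h : W -> V).
Implicit Types (f : seq V -> K) (s : seq W).

Lemma dsum_map (phi : V -> seq V -> K) s :
  dsum phi (map h s) = dsum (fun x u => phi (h x) (map h u)) s.
Proof. by elim: s phi => //= x t IHt phi; rewrite IHt. Qed.

Lemma alt_map f s : alt f (map h s) = alt (fun u => f (map h u)) s.
Proof.
rewrite /alt size_map; move: (size s) => n; elim: n f s => //= n IH f s.
rewrite dsum_map; congr (_ * _); apply: eq_dsum => x u; exact: IH.
Qed.

Lemma cobd_map f s : cobd f (map h s) = cobd (fun u => f (map h u)) s.
Proof. exact: dsum_map. Qed.

End Naturality.

Lemma cobd_comm (K : realType) (A B : Type) (F : seq A -> seq B -> K) s t :
  cobd (fun p => cobd (F p) t) s = cobd (fun q => cobd (F^~ q) s) t.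
Proof.
elim: s F => [|x s IH] F; first by rewrite [RHS]cobd0.
rewrite cobd_cons (IH (fun p => F (x :: p))) -cobdB.
by apply: eq_cobd => u; rewrite cobd_cons.
Qed.

(** * Exactness from links *)

Section Links.
Variables (K : realType) (V : eqType).
Implicit Types (f g : seq V -> K) (H F : seq V -> seq V -> K).
Implicit Types (r s t w : seq V) (S : seq V -> Prop).

Definition perm_closed S := forall s t, perm_eq s t -> S s -> S t.

(** Bounded exactness in one degree of the augmented complex of alternating
    cochains on the simplices in [S].  Simplices with [j] vertices are lists of
    size [j], so size [0] is the augmentation, and exactness for [j = 0] means
    that there is a vertex.  The constant [C] is explicit so that it can be
    shared by a whole family of complexes. *)
Definition exact_at (C : K) S (j : nat) := forall f M, 0 <= M ->
  alternating f ->
  (forall t, S t -> size t = j -> `|f t| <= M) ->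
  (forall t, S t -> size t = j.+1 -> cobd f t = 0) ->
  exists g, [/\ alternating g,
    forall t, S t -> (size t).+1 = j -> `|g t| <= C * M &
    forall t, S t -> size t = j -> f t = cobd g t].

Definition exact_on (C : K) S (X : pred V) (j : nat) := forall f M, 0 <= M ->
  alternating f ->
  (forall t, S t -> size t = j -> `|f t| <= M) ->
  (forall t, S t -> size t = j.+1 -> cobd f t = 0) ->
  exists g, [/\ alternating g,
    forall t, S t -> all X t -> (size t).+1 = j -> `|g t| <= C * M &
    forall t, S t -> all X t -> size t = j -> f t = cobd g t].

Lemma exact_at_le C C' S j : C <= C' -> exact_at C S j -> exact_at C' S j.
Proof.
move=> le e f M M0 af b c; have [g [ag bg eg]] := e f M M0 af b c.
exists g; split=> // t St ts; apply: le_trans (bg t St ts) _.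
exact: ler_wpM2r.
Qed.

Lemma exact_at_iff C S S' j : (forall t, S t <-> S' t) ->
  exact_at C S j -> exact_at C S' j.
Proof.
move=> SS'; suff -> : S = S' by [].
by apply/funext => t; apply/propext; exact: SS'.
Qed.

(** The differential of the total complex of functions of two lists. *)
Definition bicobd H r w := cobd (H^~ w) r + (-1) ^+ size r * cobd (H r) w.

Lemma bicobd_cons H x r w :
  bicobd H (x :: r) w = H r w - bicobd (fun r => H (x :: r)) r w.
Proof. by rewrite /bicobd cobd_cons [size _]/= exprS mulN1r mulNr opprD addrA. Qed.

Lemma bicobd_cat f r w : bicobd (fun r w => f (r ++ w)) r w = cobd f (r ++ w).
Proof.
elim: r f => [|x r IH] f; first by rewrite /bicobd /= expr0 mul1r add0r.
by rewrite bicobd_cons cat_cons cobd_cons -IH.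
Qed.

Variable X : pred V.
Let out s := [seq x <- s | ~~ X x].
Let inn s := [seq x <- s | X x].

Fixpoint shuffle_sign s : K :=
  if s is x :: u then (if X x then (-1) ^+ size (out u) else 1) * shuffle_sign u
  else 1.

(** A function of a list outside [X] and a list in [X] becomes a function of one
    list: sort the vertices and record the sign of the shuffle.  This is a
    cochain map from the total complex. *)
Definition unshuffle H s := shuffle_sign s * H (out s) (inn s).

Lemma norm_shuffle_sign s : `|shuffle_sign s| = 1.
Proof.
elim: s => [|x s IH] /=; first by rewrite normr1.
by rewrite normrM IH mulr1; case: ifP; rewrite ?normrX ?normrN1 ?expr1n ?normr1.
Qed.

Lemma cobd_unshuffle H s : cobd (unshuffle H) s = unshuffle (bicobd H) s.
Proof.
elim: s H => [|x s IH] H; first by rewrite /unshuffle /bicobd /cobd /= !(mulr0, addr0).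
rewrite cobd_cons /=; case Xx: (X x).
  have -> : cobd (slice x (unshuffle H)) s =
      cobd (unshuffle (fun r w => (-1) ^+ size r * H r (x :: w))) s.
    by apply: eq_cobd => u; rewrite /slice /unshuffle /= Xx /= mulrCA mulrA.
  rewrite IH /unshuffle /= Xx /= /bicobd.
  have -> : cobd (fun r => (-1) ^+ size r * H r (x :: inn s)) (out s) =
      cobd (fun r => - (-1) ^+ size (out s) * H r (x :: inn s)) (out s).
    by apply: eq_cobd_size => u <-; rewrite exprS mulN1r opprK.
  rewrite !cobdZ cobd_cons -/(inn s) -/(out s) /slice.
  have e2 := sqrr_sign K (size (out s)).
  have e3 : (-1) ^+ size (out s) * (-1) ^+ size (out s) = 1 :> K by rewrite -expr2 e2.
  set e := (-1) ^+ size (out s) in e3 *.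
  set a := cobd _ _; set b := cobd _ _; set h := H _ _; set sg := shuffle_sign s.
  by transitivity (sg * h - sg * (- e * a + (e * e) * b)); first ring;
    transitivity (e * sg * a + (e * e) * sg * (h - b)); last ring; rewrite e3; ring.
have -> : cobd (slice x (unshuffle H)) s =
    cobd (unshuffle (fun r w => H (x :: r) w)) s.
  by apply: eq_cobd => u; rewrite /slice /unshuffle /= Xx mul1r.
by rewrite IH /unshuffle /= Xx /= -/(out s) -/(inn s) bicobd_cons; ring.
Qed.

Lemma alternating_move f x r w : alternating f ->
  f (r ++ x :: w) = (-1) ^+ size r * f (x :: r ++ w).
Proof.
move=> af; elim/last_ind: r w => [|r y IH] w; first by rewrite mul1r.
rewrite cat_rcons af IH size_rcons exprS cat_rcons; ring.
Qed.

Lemma unshuffle_alternating f s : alternating f ->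
  unshuffle (fun r w => f (r ++ w)) s = f s.
Proof.
elim: s f => [|x s IH] f af; first by rewrite /unshuffle /= mul1r.
have af' := @alternating_slice _ _ x _ af.
rewrite /unshuffle /=; case Xx: (X x); rewrite /= -/(out s) -/(inn s); last first.
  by rewrite mul1r; exact: (IH (slice x f)).
rewrite alternating_move // -[RHS](IH (slice x f)) // /unshuffle /slice.
rewrite -/(out s) -/(inn s).
have e2 := sqrr_sign K (size (out s)).
by rewrite mulrACA mulrA -expr2 e2 mul1r.
Qed.

Variable S : seq V -> Prop.
Hypotheses (dS : down_closed S) (pS : perm_closed S).

Let dom r w := [/\ all (predC X) r, all X w & S (r ++ w)].

Lemma dom_outside r w : dom r w -> S r.
Proof.
case=> _ _; elim/last_ind: w => [|w x IH]; first by rewrite cats0.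
by rewrite -rcons_cat -cats1 => /dS; rewrite cats0.
Qed.

Lemma dom_downl w : down_closed (dom^~ w).
Proof.
move=> s1 x s2 [a b c]; split=> //.
  by move: a; rewrite !all_cat /= => /and3P[-> _ ->].
by move: c; rewrite -!catA /=; apply: dS.
Qed.

Lemma dom_downr r : down_closed (dom r).
Proof.
move=> s1 x s2 [a b c]; split=> //.
  by move: b; rewrite !all_cat /= => /and3P[-> _ ->].
by move: c; rewrite !catA; apply: dS.
Qed.

Lemma bicobd_bound H r w M : dom r w ->
  (forall r' w', dom r' w' -> (size r' + size w').+1 = (size r + size w)%N ->
    `|H r' w'| <= M) ->
  `|bicobd H r w| <= (size r + size w)%:R * M.
Proof.
move=> d e; rewrite /bicobd natrD mulrDl (le_trans (ler_normD _ _)) // lerD //.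
  apply: (cobd_bound (dom_downl (w := w))) => // u du su; apply: e => //; lia.
rewrite normrM normrX normrN1 expr1n mul1r.
by apply: (cobd_bound (dom_downr (r := r))) => // u du su; apply: e => //; lia.
Qed.

(** The bound on the primitive after the first [i] steps of the induction on the
    number of outside vertices. *)
Fixpoint link_const (C : K) (j i : nat) : K :=
  if i is i'.+1 then link_const C j i' + C * (1 + j%:R * link_const C j i')
  else 0.

Lemma link_const_ge0 C j i : 0 <= C -> 0 <= link_const C j i.
Proof.
move=> C0; elim: i => //= i IH; rewrite addr_ge0 // mulr_ge0 // addr_ge0 //.
by rewrite mulr_ge0.
Qed.

Lemma bicobdD H F r w :
  bicobd (fun r w => H r w + F r w) r w = bicobd H r w + bicobd F r w.
Proof. by rewrite /bicobd !cobdD; ring. Qed.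

Lemma bicobdB H F r w :
  bicobd (fun r w => H r w - F r w) r w = bicobd H r w - bicobd F r w.
Proof. by rewrite /bicobd !cobdB; ring. Qed.

Lemma bicobdK H r w : bicobd (bicobd H) r w = 0.
Proof.
rewrite {1}/bicobd.
have -> : cobd (bicobd H r) w = cobd (fun w => cobd (H^~ w) r) w.
  by rewrite cobdD cobdZ cobdK mulr0 addr0.
have -> : cobd ((bicobd H)^~ w) r =
    - (-1) ^+ size r * cobd (fun r => cobd (H r) w) r.
  rewrite cobdD cobdK add0r -cobdZ; apply: eq_cobd_size => u <-.
  by rewrite exprS mulN1r opprK.
by rewrite cobd_comm mulNr addNr.
Qed.

(** The primitive is corrected step by step: once it is right on the pairs with
    at most [i] outside vertices, the error on the pairs with [i + 1] outside
    vertices [r] is closed in the second list alone, that is, it is a cocycle of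
    the link of [r], where it bounds by hypothesis. *)
Lemma tot_exact (C : K) j i F M : 0 <= C -> 0 <= M -> (i <= j)%N ->
  (forall r, S r -> all (predC X) r -> (0 < size r <= j)%N ->
     exact_at C (fun w => all X w /\ S (r ++ w)) (j - size r)) ->
  (forall r, alternating (F r)) ->
  (forall r w, dom r w -> (size r + size w)%N = j -> `|F r w| <= M) ->
  (forall w, dom [::] w -> size w = j -> F [::] w = 0) ->
  (forall r w, dom r w -> (size r + size w)%N = j.+1 -> bicobd F r w = 0) ->
  exists H, [/\ forall r, alternating (H r),
    forall r w, dom r w -> (size r + size w).+1 = j ->
      `|H r w| <= link_const C j i * M &
    forall r w, dom r w -> (size r + size w)%N = j -> (size r <= i)%N ->
      F r w = bicobd H r w].
Proof.
move=> C0 M0 + ex aF bF F0 cF; elim: i => [|i IH] lij.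
  exists (fun _ _ => 0); split=> [r s1 x y s2|r w _ _|r w d rw r0].
  - by rewrite oppr0.
  - by rewrite normr0 mul0r.
  have re : r = [::] by apply/eqP; rewrite -size_eq0; lia.
  by rewrite re F0 ?/bicobd ?cobd0 ?mulr0 ?addr0 -?re // -rw re.
have [H [aH bH eH]] := IH (ltnW lij).
set c := link_const C j i in bH *.
have c0 : 0 <= c by exact: link_const_ge0.
pose F' r w := F r w - bicobd H r w.
have aF' r : alternating (F' r).
  move=> s1 x y s2; rewrite /F' /bicobd aF.
  rewrite (alternating_cobd (aH r)).
  have -> : cobd (H^~ (s1 ++ [:: x, y & s2])) r =
      - cobd (H^~ (s1 ++ [:: y, x & s2])) r.
    by rewrite -mulN1r -cobdZ; apply: eq_cobd => u; rewrite aH mulN1r.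
  ring.
have bF' r w : dom r w -> (size r + size w)%N = j ->
    `|F' r w| <= (1 + j%:R * c) * M.
  move=> d rw; rewrite (le_trans (ler_normB _ _)) // mulrDl mul1r lerD ?bF //.
  rewrite -mulrA -{1}rw; apply: bicobd_bound => // r' w' d'; rewrite rw.
  exact: bH.
have cF' r w : dom r w -> (size r + size w)%N = j.+1 -> bicobd F' r w = 0.
  by move=> d rw; rewrite bicobdB cF // bicobdK subr0.
have F'0 r w : dom r w -> (size r + size w)%N = j -> (size r <= i)%N ->
    F' r w = 0.
  by move=> d rw ri; rewrite /F' eH // subrr.
have /choice[h hP] : forall r, exists h : seq V -> K, alternating h /\
    (S r -> all (predC X) r -> size r = i.+1 ->
     (forall w, dom r w -> (size r + size w).+1 = j ->
        `|h w| <= C * ((1 + j%:R * c) * M)) /\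
     (forall w, dom r w -> (size r + size w)%N = j -> F' r w = cobd h w)).
  move=> r; have [[Sr [ar sr]]|nr] := pselect (S r /\ all (predC X) r /\ size r = i.+1);
      last first.
    by exists (fun=> 0); split=> [s1 x y s2|a b c']; [rewrite oppr0 | case: nr].
  have MM : 0 <= (1 + j%:R * c) * M by rewrite mulr_ge0 // addr_ge0 // mulr_ge0.
  have rj : (0 < size r <= j)%N by rewrite sr.
  have [||h [ah bh eh]] := ex r Sr ar rj (F' r) _ MM (aF' r).
  - by move=> t [at_ St] st; apply: bF' => //; lia.
  - move=> t [at_ St] st; have d : dom r t by [].
    have := cF' r t d; rewrite /bicobd.
    have -> : cobd (F'^~ t) r = 0.
      rewrite -[RHS](cobd0 _ r); apply: (eq_cobd_in (dom_downl (w := t))) => // u du su.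
      apply: F'0 => //; lia.
    have sz : (size r + size t)%N = j.+1 by lia.
    move=> /(_ sz) /eqP; rewrite add0r mulf_eq0 signr_eq0 /= => /eqP //.
  exists h; split=> // _ _ _; split=> w [aw1 aw2 aw3] sw.
    by apply: bh => //; lia.
  by apply: eh => //; lia.
pose e : K := (-1) ^+ i.+1.
pose H1 r w := if size r == i.+1 then e * h r w else 0.
exists (fun r w => H r w + H1 r w); split.
- move=> r; apply: alternatingD => //.
  rewrite /H1; have [sr|sr] := eqVneq (size r) i.+1; last first.
    by move=> ? ? ? ?; rewrite oppr0.
  by apply: alternatingZ; have [] := hP r.
- move=> r w d rw; rewrite /= mulrDl (le_trans (ler_normD _ _)) // lerD ?bH //.
  rewrite /H1; case: eqP => [sr|_]; last first.
    rewrite normr0 -mulrA; apply: mulr_ge0 => //; apply: mulr_ge0 => //.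
    by rewrite addr_ge0 // mulr_ge0.
  rewrite normrM normrX normrN1 expr1n mul1r -mulrA.
  have Sr := dom_outside d.
  have [_ /(_ Sr)] := hP r; case: d => ar aw Sw /(_ ar sr)[bh _].
  by apply: bh.
move=> r w d rw ri; rewrite bicobdD.
apply/eqP; rewrite -subr_eq0 opprD addrA -/(F' r w).
have Sr := dom_outside d.
have z1 : cobd (H1^~ w) r = 0.
  rewrite -[RHS](cobd0 _ r); apply: eq_cobd_size => u su; rewrite /H1.
  by case: eqP => // su'; lia.
rewrite /bicobd z1 add0r.
have [ri'|ri'] := leqP (size r) i.
  rewrite F'0 // sub0r oppr_eq0.
  suff -> : cobd (H1 r) w = 0 by rewrite mulr0.
  rewrite -[RHS](cobd0 _ w); apply: eq_cobd_size => u su; rewrite /H1.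
  by case: eqP => // su'; lia.
have sr : size r = i.+1 by lia.
have -> : cobd (H1 r) w = e * cobd (h r) w.
  by rewrite -cobdZ; apply: eq_cobd => u; rewrite /H1 sr eqxx.
have [_ /(_ Sr)] := hP r; case: (d) => ar aw Sw /(_ ar sr)[_ eh].
rewrite sr -/e mulrA -expr2 sqrr_sign mul1r.
by rewrite (eh w) // subrr.
Qed.

(** A cocycle that bounds on the lists in [X] can be changed by a coboundary so
    that it vanishes on them; what is left is spread over the links in [X] of the
    simplices outside [X], and the exactness of these links removes it. *)
Lemma link_exact (C C0 : K) j : 0 <= C -> 0 <= C0 ->
  exact_on C0 S X j ->
  (forall r, S r -> all (predC X) r -> (0 < size r <= j)%N ->
     exact_at C (fun w => all X w /\ S (r ++ w)) (j - size r)) ->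
  exact_at (C0 + link_const C j j * (1 + j%:R * C0)) S j.
Proof.
move=> C_ge0 C0_ge0 eX eL f M M0 af bf cf.
have [g0 [ag0 bg0 eg0]] := eX f M M0 af bf cf.
pose g1 t := if `[< all X t /\ S t >] then g0 t else 0.
have ag1 : alternating g1.
  move=> s1 x y s2; rewrite /g1.
  have p : perm_eq (s1 ++ [:: x, y & s2]) (s1 ++ [:: y, x & s2]).
    by rewrite perm_cat2l -[[:: x, y & _]]/([:: x] ++ [:: y] ++ s2) perm_catCA.
  have -> : `[< all X (s1 ++ [:: x, y & s2]) /\ S (s1 ++ [:: x, y & s2]) >] =
            `[< all X (s1 ++ [:: y, x & s2]) /\ S (s1 ++ [:: y, x & s2]) >].
    rewrite (perm_all _ p); congr asbool; apply/propext.
    split=> -[a b]; split=> //; last by move: b; apply: pS; rewrite perm_sym.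
    by move: b; exact: pS.
  by case: ifP => _; rewrite ?oppr0.
have dXS : down_closed (fun t => all X t /\ S t).
  move=> s1 x s2 [a b]; split; last exact: dS b.
  by move: a; rewrite !all_cat /= => /and3P[-> _ ->].
pose f1 t := f t - cobd g1 t.
have af1 : alternating f1.
  by move=> s1 x y s2; rewrite /f1 af (alternating_cobd ag1); ring.
have M1 : 0 <= (1 + j%:R * C0) * M by rewrite mulr_ge0 // addr_ge0 // mulr_ge0.
have bf1 t : S t -> size t = j -> `|f1 t| <= (1 + j%:R * C0) * M.
  move=> St st; rewrite mulrDl mul1r (le_trans (ler_normB _ _)) // lerD ?bf //.
  rewrite -mulrA -{1}st; apply: (cobd_bound dS) => // u Su su.
  rewrite /g1; case: asboolP => [[a b]|_]; first by apply: bg0 => //; lia.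
  by rewrite normr0 mulr_ge0.
have f10 t : all X t -> S t -> size t = j -> f1 t = 0.
  move=> at_ St st; rewrite /f1 (eg0 t) //; apply/eqP; rewrite subr_eq0; apply/eqP.
  apply: (eq_cobd_in dXS) => // u [au Su] su; rewrite /g1.
  by case: asboolP => // -[].
have cf1 t : S t -> size t = j.+1 -> cobd f1 t = 0.
  by move=> St st; rewrite cobdB cf // cobdK subr0.
have [||||H [aH bH eH]] := @tot_exact C j j (fun r w => f1 (r ++ w)) _ C_ge0 M1 (leqnn j) eL.
- by move=> r s1 x y s2; rewrite !catA af1.
- by move=> r w [a b c] rw; apply: bf1; rewrite ?size_cat.
- by move=> w [a b c] sw; apply: f10.
- by move=> r w [a b c] rw; rewrite bicobd_cat cf1 // size_cat.
exists (fun t => g1 t + alt (unshuffle H) t); split.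
- apply: alternatingD => //; exact: alternating_alt.
- move=> t St st; rewrite mulrDl (le_trans (ler_normD _ _)) // lerD //.
    rewrite /g1; case: asboolP => [[a b]|_]; first by apply: bg0 => //; lia.
    by rewrite normr0 mulr_ge0.
  apply: alt_bound => u put; rewrite /unshuffle normrM norm_shuffle_sign mul1r -mulrA.
  have pu : perm_eq (out u ++ inn u) u by rewrite perm_catC perm_filterC.
  apply: bH; last by rewrite -size_cat (perm_size pu) (perm_size put).
  split; rewrite ?filter_all //; apply: (pS _ St); rewrite perm_sym.
  exact: perm_trans pu put.
move=> t St st; rewrite cobdD cobd_alt.
have -> : alt (cobd (unshuffle H)) t = f1 t; last by rewrite /f1 addrC subrK.
rewrite -(alt_id t af1); apply/eqP; rewrite -subr_eq0 -altB -normr_le0.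
apply: alt_bound => u put; rewrite cobd_unshuffle.
have Su : S u by apply: (pS _ St); rewrite perm_sym.
have pu : perm_eq (out u ++ inn u) u by rewrite perm_catC perm_filterC.
rewrite -[f1 u](unshuffle_alternating u af1) /unshuffle -mulrBr -/(out u) -/(inn u).
rewrite eH ?subrr ?mulr0 ?normr0 //.
- by split; rewrite ?filter_all //; apply: (pS _ Su); rewrite perm_sym.
- by rewrite -size_cat (perm_size pu) (perm_size put).
- by rewrite -st -(perm_size put) -(perm_size pu) size_cat leq_addr.
Qed.

End Links.

(** * Unimodular lists and the stable range condition *)

Lemma perm_swap (T : eqType) (x y : T) r : perm_eq [:: x, y & r] [:: y, x & r].
Proof. by apply/permP => a /=; rewrite addnCA. Qed.

Section Covectors.
Variables (R : pzRingType) (N : nat).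
Implicit Types (phi psi : 'cV[R]_N -> R) (u v x y : 'cV[R]_N) (r t : seq 'cV[R]_N).

Definition covec phi :=
  (forall u v, phi (u + v) = phi u + phi v) /\
  (forall u a, phi (u *m a%:M) = phi u * a).

Definition rowfun (c : 'rV[R]_N) x : R := (c *m x) 0 0.

Lemma covec_row c : covec (rowfun c).
Proof.
split=> [u v|u a]; first by rewrite /rowfun mulmxDr mxE.
by rewrite /rowfun mulmxA mxE big_ord1 [a%:M _ _]mxE.
Qed.

Lemma col_sum x : x = \sum_i delta_mx i 0 *m (x i 0)%:M.
Proof.
apply/colP => i; rewrite summxE (bigD1 i) //= big1 ?addr0.
  by rewrite mxE big_ord1 !mxE !eqxx mulr1n mul1r.
move=> j ji; rewrite mxE big_ord1 !mxE !eqxx andbT mulr1n.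
by rewrite eq_sym (negPf ji) mul0r.
Qed.

Lemma covec0 phi : covec phi -> phi 0 = 0.
Proof. by case=> _ /(_ 0 0); rewrite mul0mx mulr0. Qed.

Lemma covecN phi u : covec phi -> phi (- u) = - phi u.
Proof.
move=> cp; apply/eqP; rewrite -subr_eq0 opprK; apply/eqP.
by have [<- _] := cp; rewrite addNr covec0.
Qed.

Lemma covecB phi u v : covec phi -> phi (u - v) = phi u - phi v.
Proof. by move=> cp; have [-> _] := cp; rewrite covecN. Qed.

Lemma covecP phi : covec phi -> exists c, phi = rowfun c.
Proof.
move=> cp; exists (\row_j phi (delta_mx j 0)); apply/funext => x.
rewrite {1}(col_sum x) (big_morph phi (proj1 cp) (covec0 cp)) /rowfun mxE.
by apply: eq_bigr => i _; rewrite mxE (proj2 cp).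
Qed.

Lemma covec_sub phi psi : covec phi -> covec psi -> covec (fun x => phi x - psi x).
Proof.
move=> [pD pZ] [qD qZ]; split=> [u v|u a]; first by rewrite pD qD opprD addrACA.
by rewrite pZ qZ mulrBl.
Qed.

Lemma covec_add phi psi : covec phi -> covec psi -> covec (fun x => phi x + psi x).
Proof.
move=> [pD pZ] [qD qZ]; split=> [u v|u a]; first by rewrite pD qD addrACA.
by rewrite pZ qZ mulrDl.
Qed.

Lemma covec_scale a phi : covec phi -> covec (fun x => a * phi x).
Proof.
by move=> [pD pZ]; split=> [u v|u b]; rewrite ?pD ?mulrDr // pZ mulrA.
Qed.

Lemma covec_comp phi (f : 'cV[R]_N -> 'cV[R]_N) :
  covec phi -> right_linear f -> covec (phi \o f).
Proof.
by move=> [pD pZ] [fD fZ]; split=> [u v|u a] /=; rewrite ?fD ?fZ ?pD ?pZ.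
Qed.

(** Partial bases, through dual covectors.  Quantifying over the ways to single
    out one entry makes the notion invariant under permutations by definition,
    and it does not exclude repetitions over the zero ring. *)
Definition ulist t := forall x r, perm_eq t (x :: r) ->
  exists phi, [/\ covec phi, phi x = 1 & forall y, y \in r -> phi y = 0].

Lemma ulist_perm t t' : perm_eq t t' -> ulist t -> ulist t'.
Proof. by move=> p ut x r p'; apply: ut; apply: perm_trans p'. Qed.

Lemma ulist_behead x t : ulist (x :: t) -> ulist t.
Proof.
move=> uxt y r p.
have [|phi [cp p1 p0]] := uxt y (x :: r).
  by rewrite perm_sym (perm_trans (perm_swap _ _ _)) // perm_cons perm_sym.
by exists phi; split=> // z zr; apply: p0; rewrite inE zr orbT.
Qed.

Lemma ulist_down s1 x s2 : ulist (s1 ++ x :: s2) -> ulist (s1 ++ s2).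
Proof.
move=> u; apply: (@ulist_behead x); apply: ulist_perm u.
by rewrite -cat1s perm_catCA.
Qed.

Lemma ulist1 phi x : covec phi -> phi x = 1 -> ulist [:: x].
Proof.
move=> cp p1 y r p.
have /perm_size := p; case: r p => //= p _.
have : y \in [:: x] by rewrite (perm_mem p) inE.
by rewrite inE => /eqP->; exists phi.
Qed.

Definition proj_along v psi u := u - v *m (psi u)%:M.

Lemma right_linear_proj v psi : covec psi -> right_linear (proj_along v psi).
Proof.
move=> [pD pZ]; rewrite /proj_along; split=> [x y|x a].
  by rewrite pD raddfD mulmxDr opprD addrACA.
by rewrite pZ mulmxBl -mulmxA scalar_mxM.
Qed.

(** A covector dual to [v] is obtained from [psi] by subtracting the dual
    covectors of the other entries one at a time; they vanish at [v], so the
    value at [v] is preserved. *)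
Lemma dual_correction v psi r : covec psi -> psi v = 1 ->
  (forall x r', perm_eq r (x :: r') -> exists phi,
     [/\ covec phi, phi v = 0, phi x = 1 & forall y, y \in r' -> phi y = 0]) ->
  exists phi, [/\ covec phi, phi v = 1 & forall y, y \in r -> phi y = 0].
Proof.
move=> cpsi psi1 dual.
suff H r1 r2 : r = r1 ++ r2 ->
    exists phi, [/\ covec phi, phi v = 1 & forall y, y \in r1 -> phi y = 0].
  by have [] := H r [::]; rewrite ?cats0 // => phi; exists phi.
elim/last_ind: r1 r2 => [|r1 x IH] r2 re; first by exists psi.
have [|phi [cp p1 p0]] := IH (x :: r2); first by rewrite re cat_rcons.
have [|chi [cc c0 c1 cr]] := dual x (r1 ++ r2).
  by rewrite re cat_rcons -cat1s perm_catCA.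
exists (fun z => phi z - phi x * chi z); split.
- exact/covec_sub/covec_scale.
- by rewrite c0 mulr0 subr0.
move=> y; rewrite mem_rcons inE => /orP[/eqP->|yr].
  by rewrite c1 mulr1 subrr.
by rewrite p0 // cr ?mulr0 ?subr0 // mem_cat yr.
Qed.

(** Projecting along a vector [v] of the list identifies the quotient by the line
    of [v] with the kernel of [psi]. *)
Lemma ulist_proj v psi r : covec psi -> psi v = 1 ->
  ulist (v :: r) <-> ulist (map (proj_along v psi) r).
Proof.
move=> cpsi psi1; set p := proj_along v psi.
have lp : right_linear p by exact: right_linear_proj.
have pv : p v = 0 by rewrite /p /proj_along psi1 mulmx1 subrr.
split=> [u x r'' pe|u].
  have /mapP[y yr xy] : x \in map p r by rewrite (perm_mem pe) inE eqxx.
  have pr := perm_to_rem yr.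
  have [|phi [cp p1 p0]] := u y (v :: rem y r).
    by rewrite perm_sym (perm_trans (perm_swap _ _ _)) // perm_cons perm_sym.
  have phip z : phi (p z) = phi z.
    by rewrite /p /proj_along covecB // (proj2 cp) (p0 v) ?mem_head // mul0r subr0.
  exists phi; split=> //; first by rewrite xy phip.
  move=> z zr.
  have : perm_eq r'' (map p (rem y r)).
    rewrite -(perm_cons x) perm_sym (perm_trans _ pe) // xy -map_cons.
    by apply: perm_map; rewrite perm_sym.
  move/perm_mem => e; move: zr; rewrite e => /mapP[w wr ->].
  by rewrite phip p0 // inE wr orbT.
have dual x r' : perm_eq r (x :: r') -> exists phi,
     [/\ covec phi, phi v = 0, phi x = 1 & forall y, y \in r' -> phi y = 0].
  move=> pe; have [|phi [cp p1 p0]] := u (p x) (map p r').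
    by rewrite -map_cons perm_map.
  exists (phi \o p); split=> //=; first exact: covec_comp.
    by rewrite pv covec0.
  by move=> y yr; apply: p0; rewrite map_f.
move=> x r' pe.
have xv : x \in v :: r by rewrite (perm_mem pe) inE eqxx.
have [xe|xv'] := eqVneq x v.
  have [phi [cp p1 p0]] := dual_correction cpsi psi1 dual.
  exists phi; split=> //; first by rewrite xe.
  move=> y yr; apply: p0; move: pe; rewrite xe perm_cons => /perm_mem->.
  by [].
have vr' : v \in r'.
  have : v \in x :: r' by rewrite -(perm_mem pe) inE eqxx.
  by rewrite inE eq_sym (negPf xv').
have pr' := perm_to_rem vr'.
have [|phi [cp pv0 p1 p0]] := dual x (rem v r').
  rewrite -(perm_cons v) (perm_trans pe) //.
  by rewrite perm_sym (perm_trans (perm_swap _ _ _)) // perm_cons perm_sym.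
exists phi; split=> // y; rewrite (perm_mem pr') inE => /orP[/eqP->//|]; exact: p0.
Qed.

Lemma ulist2 phi psi x y : covec phi -> phi x = 1 -> phi y = 0 ->
  covec psi -> psi y = 1 -> ulist [:: x; y].
Proof.
move=> cp p1 p0 cq q1; apply/(ulist_proj _ cp p1) => /=.
by rewrite /proj_along p0 raddf0 mulmx0 subr0; exact: ulist1 q1.
Qed.

End Covectors.

Section StableRange.
Variable R : pzRingType.

(** The coefficient along a free direct summand of rank one is a covector;
    conversely the kernel of a covector with value [1] is a complement. *)
Lemma unimodularP l (v : 'cV[R]_l) :
  unimodular v <-> exists c : 'rV[R]_l, c *m v = 1%:M.
Proof.
split=> [[vfree [[]] _ _ _ [W [[W0 WD WZ] dec disj]]]|[c cv]]; last first.
  have cE (a : R) : c *m (v *m a%:M) = a%:M by rewrite mulmxA cv mul1mx.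
  split.
    move=> a va0; have := cE a; rewrite va0 mulmx0 => /matrixP/(_ 0 0).
    by rewrite !mxE eqxx mulr1n.
  split.
    split; first by exists 0 => //; rewrite raddf0 mulmx0.
      move=> _ _ [a _ <-] [b _ <-]; exists (a + b) => //.
      by rewrite raddfD mulmxDr.
    move=> _ b [a _ <-]; exists (a * b) => //.
    by rewrite scalar_mxM mulmxA.
  exists (fun x : 'cV[R]_l => c *m x = 0); split.
  - split=> /=; first by rewrite mulmx0.
      by move=> x y xE yE; rewrite mulmxDr xE yE addr0.
    by move=> x a xE; rewrite mulmxA xE mul0mx.
  - move=> x; exists (v *m ((c *m x) 0 0)%:M), (x - v *m ((c *m x) 0 0)%:M).
    split; first by exists ((c *m x) 0 0).
      by rewrite /= mulmxBr cE -mx11_scalar subrr.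
    by rewrite addrC subrK.
  - move=> x [a _ <-] /=; rewrite cE => /matrixP/(_ 0 0).
    by rewrite !mxE eqxx mulr1n => ->; rewrite raddf0 mulmx0.
have WN x : W x -> W (- x).
  by move=> Wx; have := WZ x (-1) Wx; rewrite raddfN mulmxN mulmx1.
have uniq a b x y : W x -> W y -> v *m a%:M + x = v *m b%:M + y -> a = b.
  move=> Wx Wy e; apply/eqP; rewrite -subr_eq0; apply/eqP/vfree; apply: disj.
    by exists (a - b).
  have -> : v *m (a - b)%:M = y - x; last by apply: WD => //; exact: WN.
  have -> : y - x = v *m a%:M - v *m b%:M; last by rewrite raddfB mulmxBr.
  by apply/eqP; rewrite subr_eq addrAC eq_sym subr_eq e addrC eqxx.
have /choice[phi phiP] x : exists a, exists2 w, W w & x = v *m a%:M + w.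
  by have [_ [w [[a _ <-] Ww ->]]] := dec x; exists a, w.
have cphi : covec phi.
  split=> [x y|x a].
    have [w Ww e] := phiP x; have [w' Ww' e'] := phiP y.
    have [w2 Ww2 e2] := phiP (x + y).
    apply: (uniq _ _ w2 (w + w')) => //; first exact: WD.
    by rewrite -e2 {1}e {1}e' raddfD mulmxDr addrACA.
  have [w Ww e] := phiP x; have [w2 Ww2 e2] := phiP (x *m a%:M).
  apply: (uniq _ _ w2 (w *m a%:M)) => //; first exact: WZ.
  by rewrite -e2 {1}e mulmxDl scalar_mxM mulmxA.
have [c pc] := covecP cphi; exists c; apply/matrixP => i j; rewrite !ord1.
have -> : (c *m v) 0 0 = phi v by rewrite pc.
rewrite [RHS]mxE eqxx mulr1n.
have [w Ww e] := phiP v; apply: (uniq _ _ w 0) => //.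
by rewrite -e mulmx1 addr0.
Qed.

Variable s : nat.
Hypothesis srs : SR R s.+1.

Lemma SR_row m (x : 'cV[R]_m) (a : 'M[R]_1) (w : 'rV[R]_m) (b : 'M[R]_1) :
  (s <= m)%N -> w *m x + b *m a = 1%:M ->
  exists t : 'cV[R]_m, exists c : 'rV[R]_m, c *m (x + t *m a) = 1%:M.
Proof.
move=> sm wb.
have sm1 : (s.+1 <= m + 1)%N by rewrite addn1.
have [|t /unimodularP[c cE]] := srs sm1 (r := col_mx x a).
  by apply/unimodularP; exists (row_mx w b); rewrite mul_row_col.
exists (\col_i t i), c; rewrite -[RHS]cE; congr (_ *m _); apply/colP => i.
by rewrite [RHS]mxE col_mxEu col_mxEd !mxE big_ord1 !mxE.
Qed.

(** A unimodular vector [v] can be separated from a corank-one part of any split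
    free submodule of large rank: the first use of the stable range condition
    adjusts the retraction onto the submodule so that the image of [v] becomes
    unimodular, the second one finds a form on the submodule that takes the
    value [1] on this image and has a free kernel, parametrized by [D]. *)
Lemma split_off n N (B : 'M[R]_(N, n + 1)) (C : 'M[R]_(n + 1, N))
    (v : 'cV[R]_N) (r : 'rV[R]_N) :
  (s <= n)%N -> C *m B = 1%:M -> r *m v = 1%:M ->
  exists (D : 'M[R]_(n + 1, n)) (C2 : 'M[R]_(n, N)) (psi : 'rV[R]_N),
    [/\ C2 *m (B *m D) = 1%:M, psi *m (B *m D) = 0, psi *m v = 1%:M &
        forall z : 'cV[R]_(n + 1),
          psi *m (B *m z) = 0 -> D *m (C2 *m (B *m z)) = z].
Proof.
move=> sn CB rv.
have [||t [c]] := @SR_row (n + 1) (C *m v) (r *m (v - B *m (C *m v))) (r *m B) 1%:M.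
- by rewrite addn1 ltnW.
- by rewrite mul1mx mulmxBr !mulmxA addrC subrK.
(* [C'] is another retraction onto the image of [B], and it sends [v] to a
   unimodular vector [x] *)
set C' := C + t *m (r *m (1%:M - B *m C)).
have C'B : C' *m B = 1%:M.
  by rewrite /C' mulmxDl CB -!mulmxA mulmxBl mul1mx -mulmxA CB mulmx1 subrr !mulmx0 addr0.
have -> : C *m v + t *m (r *m (v - B *m (C *m v))) = C' *m v.
  by rewrite /C' mulmxDl -!mulmxA mulmxBl mul1mx -mulmxA.
move=> cx; set x := C' *m v in cx.
rewrite -[x]vsubmxK -[c]hsubmxK mul_row_col in cx.
have [|t2 [e eE]] := @SR_row n _ _ _ _ _ cx; first by [].
set x' := usubmx x in cx eE; set a := dsubmx x in cx eE.
(* the form [z' + t2 a -> e (z' + t2 a)] takes the value [1] at [x]; adding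
   [1 - a] times it to the last coordinate gives the form [psi0] *)
have [f fE] : exists f, f = (1%:M - a) *m e by exists ((1%:M - a) *m e).
pose psi0 := row_mx f (1%:M + f *m t2).
exists (col_mx (1%:M + t2 *m f) (- f)), (row_mx 1%:M t2 *m C'), (psi0 *m C').
split.
- by rewrite !mulmxA -[_ *m C' *m B]mulmxA C'B mulmx1 mul_row_col mul1mx mulmxN addrK.
- rewrite !mulmxA -[_ *m C' *m B]mulmxA C'B mulmx1 mul_row_col.
  by rewrite mulmxDr mulmxN mulmxDl mul1mx mulmx1 mulmxA subrr.
- rewrite -mulmxA -/x -[x]vsubmxK -/x' -/a mul_row_col mulmxDl mul1mx addrCA.
  by rewrite -[f *m t2 *m a]mulmxA -mulmxDr fE -mulmxA eE mulmx1 addrC subrK.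
have C'Bz z : C' *m (B *m z) = z by rewrite mulmxA C'B mul1mx.
move=> z; rewrite -!mulmxA C'Bz.
rewrite -[z]vsubmxK; move: (usubmx z) (dsubmx z) => z1 z2.
rewrite !mul_row_col mul_col_mx mul1mx !mulmxDl !mul1mx mulNmx addrCA.
rewrite -[f *m t2 *m z2]mulmxA -mulmxDr => /eqP; rewrite addr_eq0 => /eqP z2E.
rewrite -z2E; congr col_mx.
by rewrite -mulmxA -[f *m _]opprK -z2E mulmxN addrK.
Qed.

End StableRange.

(** * Exactness of the complex of unimodular lists *)

Section UnimodularExact.
Variables (K : realType) (R : pzRingType) (s : nat).
Hypotheses (s_gt0 : (0 < s)%N) (srs : SR R s.+1).

Section Ambient.
Variable N : nat.
Implicit Types (t w rho tau : seq 'cV[R]_N).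

Definition in_span n (B : 'M[R]_(N, n)) : pred 'cV[R]_N :=
  fun v => `[< exists x, v = B *m x >].

Definition link_in n (B : 'M[R]_(N, n)) tau t : Prop :=
  all (in_span B) t /\ ulist (t ++ tau).

Lemma link_in_down n (B : 'M[R]_(N, n)) tau : down_closed (link_in B tau).
Proof.
move=> s1 x s2 [a u]; split; first by move: a; rewrite !all_cat /= => /and3P[-> _ ->].
by move: u; rewrite -!catA /=; exact: ulist_down.
Qed.

Lemma link_in_perm n (B : 'M[R]_(N, n)) tau : perm_closed (link_in B tau).
Proof.
move=> t1 t2 p [a u]; split; first by rewrite -(perm_all _ p).
by apply: ulist_perm u; rewrite perm_cat2r.
Qed.

Lemma sub_span n m (B : 'M[R]_(N, n)) (D : 'M[R]_(n, m)) t :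
  all (in_span (B *m D)) t -> all (in_span B) t.
Proof.
move=> /allP a; apply/allP => x /a /asboolP[y ->]; apply/asboolP.
by exists (D *m y); rewrite mulmxA.
Qed.

(** Let [c] vanish on the smaller module and take the value [1] at [v].  Then the
    link of [v :: tau] and [rho] in the smaller module is the link of one vector
    less, because [v] can be split off along [c]. *)
Lemma link_in_proj n m (B : 'M[R]_(N, n)) (D : 'M[R]_(n, m)) (c : 'rV[R]_N)
    v tau rho w :
  c *m (B *m D) = 0 -> c *m v = 1%:M -> all (in_span B) rho ->
  link_in (B *m D) (map (proj_along v (rowfun c)) (rho ++ tau)) w <->
  all (in_span (B *m D)) w /\ link_in B (v :: tau) (rho ++ w).
Proof.
move=> cB cv ar; have cc := covec_row c.
have c1 : rowfun c v = 1 by rewrite /rowfun cv mxE eqxx.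
have e : all (in_span (B *m D)) w ->
    (ulist (w ++ map (proj_along v (rowfun c)) (rho ++ tau)) <->
     ulist ((rho ++ w) ++ v :: tau)).
  move=> aw.
  have -> : w ++ map (proj_along v (rowfun c)) (rho ++ tau) =
      map (proj_along v (rowfun c)) (w ++ (rho ++ tau)).
    rewrite [RHS]map_cat; congr (_ ++ _); rewrite -[LHS]map_id.
    apply/eq_in_map => x /(allP aw) /asboolP[y ->].
    by rewrite /proj_along /rowfun mulmxA cB mul0mx mxE raddf0 mulmx0 subr0.
  have p : perm_eq (v :: w ++ rho ++ tau) ((rho ++ w) ++ v :: tau).
    by rewrite -[in X in perm_eq _ X]cat1s perm_sym perm_catCA /= perm_cons -catA perm_catCA.
  split=> [/(ulist_proj _ cc c1)|u]; first exact: ulist_perm p.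
  by apply/(ulist_proj _ cc c1); apply: ulist_perm u; rewrite perm_sym.
rewrite /link_in; split=> [[aw u]|[aw [_ u]]]; split=> //; last exact/e.
split; last exact/e.
by rewrite all_cat ar (sub_span aw).
Qed.

Lemma exact_on_at n m (B : 'M[R]_(N, n)) (D : 'M[R]_(n, m)) (C : K) tau j :
  exact_at C (fun w => all (in_span (B *m D)) w /\ link_in B tau w) j ->
  exact_on C (link_in B tau) (in_span (B *m D)) j.
Proof.
move=> e f M M0 af bf cf.
have [||g [ag bg eg]] := e f M M0 af.
- by move=> t [_]; exact: bf.
- by move=> t [_]; exact: cf.
by exists g; split=> // t St at_; [apply: bg | apply: eg].
Qed.

End Ambient.

Lemma uniform_const (P : nat -> K -> Prop) j :
  (forall m C C', C <= C' -> P m C -> P m C') ->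
  (forall m, (m <= j)%N -> exists2 C, 0 <= C & P m C) ->
  exists2 C, 0 <= C & forall m, (m <= j)%N -> P m C.
Proof.
move=> mono; elim: j => [|j IH] e.
  by have [C C0 PC] := e 0 isT; exists C => // m; case: m.
have [C C0 PC] := IH (fun m lm => e m (leqW lm)).
have [C' C'0 PC'] := e j.+1 (leqnn _).
exists (C + C'); first exact: addr_ge0.
move=> m; rewrite leq_eqVlt => /orP[/eqP->|]; first by apply: mono PC'; rewrite lerDr.
by rewrite ltnS => lm; apply: mono (PC m lm); rewrite lerDl.
Qed.

Definition uniformly_exact N n k j (C : K) :=
  forall (B : 'M[R]_(N, n)) (B' : 'M[R]_(n, N)) tau, B' *m B = 1%:M ->
    ulist tau -> size tau = k -> exact_at C (link_in B tau) j.

Lemma coord_ulist N n (B : 'M[R]_(N, n)) (B' : 'M[R]_(n, N)) (i : 'I_n) :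
  B' *m B = 1%:M -> rowfun (delta_mx 0 i *m B') (B *m delta_mx i 0) = 1.
Proof.
by move=> BB; rewrite /rowfun -mulmxA (mulmxA B') BB mul1mx mul_delta_mx mxE !eqxx.
Qed.

(** Every unimodular [x] with coordinates [(x', a)] is joined to a fixed basis
    vector of the hyperplane through [(- t, 1)], where [x' + t a] is
    unimodular. *)
Lemma uniformly_exact_1 N n : (s <= n)%N -> @uniformly_exact N (n + 1) 0 1 1.
Proof.
move=> sn B B' tau BB _ /size0nil->.
have n_gt0 : (0 < n)%N by exact: leq_trans sn.
pose i0 : 'I_n := Ordinal n_gt0.
pose w0 : 'cV[R]_N := B *m col_mx (delta_mx i0 0) 0.
pose last : 'rV[R]_(n + 1) := row_mx 0 1%:M.
have edge f t : link_in B [::] t -> (forall t, link_in B [::] t -> size t = 2%N ->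
    cobd f t = 0 :> K) -> forall x y, t = [:: x; y] -> f [:: x] = f [:: y].
  move=> St cf x y te; have := cf t St; rewrite te => /(_ erefl).
  by rewrite /cobd /= subr0 => /eqP; rewrite subr_eq0 => /eqP.
have rowE (c : 'rV[R]_(n + 1)) y : rowfun (c *m B') (B *m y) = (c *m y) 0 0.
  by rewrite /rowfun -mulmxA (mulmxA B') BB mul1mx.
have span y : in_span B (B *m y) by apply/asboolP; exists y.
have one : (1%:M : 'M[R]_1) 0 0 = 1 by rewrite mxE eqxx.
have Sw0 : link_in B [::] [:: w0].
  split; first by rewrite /= span.
  apply: (@ulist1 _ _ (rowfun (row_mx (delta_mx 0 i0) 0 *m B'))).
    exact: covec_row.
  by rewrite rowE mul_row_col mul0mx addr0 mul_delta_mx mxE !eqxx.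
move=> f M M0 af bf cf.
exists (fun t => if t is [::] then f [:: w0] else 0); split.
- by move=> [|? ?] ? ? ?; rewrite oppr0.
- by move=> t St [/size0nil->]; rewrite mul1r bf.
move=> t St st; case: t st St => [|x [|]] // _ Sx; rewrite /cobd /= subr0.
have [/= /andP[/asboolP[y xe] _] ux] := Sx.
have [phi [cphi phix _]] := ux x [::] (perm_refl _).
have [r phiE] := covecP cphi.
have ry : (r *m B) *m y = 1%:M.
  by rewrite -mulmxA -xe [LHS]mx11_scalar -/(rowfun r x) -phiE phix.
set y' := usubmx y; set a := dsubmx y.
have yE : y = col_mx y' a by rewrite vsubmxK.
rewrite yE -[r *m B]hsubmxK mul_row_col in ry.
have [t [c cE]] := SR_row srs sn ry.
pose z : 'cV[R]_N := B *m col_mx (- t) 1%:M.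
have lastz : rowfun (last *m B') z = 1.
  by rewrite rowE mul_row_col mul0mx add0r mul1mx one.
have Sxz : link_in B [::] [:: x; z].
  split; first by rewrite /= xe !span.
  rewrite cats0; apply: (@ulist2 _ _ (rowfun (row_mx c (c *m t) *m B'))
    (rowfun (last *m B'))) => //.
  - exact: covec_row.
  - by rewrite xe rowE yE mul_row_col -mulmxA -mulmxDr cE one.
  - by rewrite rowE mul_row_col mulmx1 mulmxN addNr mxE.
  - exact: covec_row.
have Szw : link_in B [::] [:: z; w0].
  split; first by rewrite /= !span.
  rewrite cats0; apply: (@ulist2 _ _ (rowfun (last *m B'))
    (rowfun (row_mx (delta_mx 0 i0) 0 *m B'))) => //.
  - exact: covec_row.
  - by rewrite rowE mul_row_col mul0mx add0r mul1mx mxE.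
  - exact: covec_row.
  - by rewrite rowE mul_row_col mul0mx addr0 mul_delta_mx mxE !eqxx.
rewrite (edge f _ Sxz cf x z erefl); exact: (edge f _ Szw cf z w0 erefl).
Qed.

Lemma uniformly_exact_0 N n : (0 < n)%N -> @uniformly_exact N n 0 0 0.
Proof.
move=> n_gt0 B B' tau BB _ /size0nil-> f M M0 af bf cf.
pose i0 : 'I_n := Ordinal n_gt0; pose e : 'cV[R]_N := B *m delta_mx i0 0.
have Se : link_in B [::] [:: e].
  split; first by rewrite /= andbT; apply/asboolP; exists (delta_mx i0 0).
  exact: (ulist1 (covec_row _) (coord_ulist i0 BB)).
exists (fun=> 0); split=> //; first by move=> ? ? ? ?; rewrite oppr0.
move=> t _ /size0nil->; have := cf _ Se erefl; rewrite /cobd /= subr0 => ->.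
by [].
Qed.

(** Induction on the rank [n] with the link lemma.  If [tau] is not empty, split
    off one of its vectors along a submodule of rank [n - 1]: all the links in
    this submodule, including the one of [tau] itself, are again of the form
    considered, with rank and number of constraints both lowered by one.  If
    [tau] is empty, take a coordinate hyperplane; cochains on it bound because
    it is coned off by the last basis vector, and the link of [m] outside vectors
    has rank [n - 1] and [m] constraints.  This second step loses two units for
    one degree, hence the slope two in [j]. *)
Lemma unimodular_exact N n k j : (s + (2 * j - 1) + k <= n)%N ->
  exists2 C : K, 0 <= C & uniformly_exact N n k j C.
Proof.
elim: n k j => [|n IH] k j le; first by lia.
rewrite -addn1.
have [Cl Cl0 links] : exists2 C : K, 0 <= C & forall m, (m <= j)%N ->
    (s + (2 * (j - m) - 1) + (k.-1 + m) <= n)%N ->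
    uniformly_exact N n (k.-1 + m) (j - m) C.
  apply: uniform_const => [m C C' CC' e lm B B' tau BB ut st|m mj].
    exact: exact_at_le CC' (e lm B B' tau BB ut st).
  have [l|l] := leqP (s + (2 * (j - m) - 1) + (k.-1 + m)) n; last by exists 0.
  by have [C C0 eC] := IH _ _ l; exists C.
case: k le links => [|k] le links; last first.
  exists (Cl + link_const Cl j j * (1 + j%:R * Cl)).
    by rewrite addr_ge0 // mulr_ge0 ?link_const_ge0 // addr_ge0 // mulr_ge0.
  move=> B B' [|v tau] // BB ut [st].
  have [phi [cphi phiv _]] := ut v tau (perm_refl _).
  have [r phiE] := covecP cphi.
  have rv : r *m v = 1%:M by rewrite [LHS]mx11_scalar -/(rowfun r v) -phiE phiv.
  have [|D [C2 [c [CBD cB cv _]]]] := split_off srs _ BB rv; first by lia.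
  have lk rho : link_in B (v :: tau) rho -> (size rho <= j)%N ->
      (s + (2 * (j - size rho) - 1) + (k + size rho) <= n)%N ->
      exact_at Cl (fun w => all (in_span (B *m D)) w /\
        link_in B (v :: tau) (rho ++ w)) (j - size rho).
    move=> [ar ur] lr ln; apply: (exact_at_iff (fun w => link_in_proj _ w cB cv ar)).
    apply: (links _ lr ln _ _ _ CBD); last by rewrite size_map size_cat st addnC.
    have cc := covec_row c.
    apply/(ulist_proj _ cc); first by rewrite /rowfun cv mxE eqxx.
    by apply: ulist_perm ur; rewrite -cat1s perm_catCA.
  apply: link_exact => //.
  - exact: link_in_down.
  - exact: link_in_perm.
  - apply: exact_on_at; have := lk [::] _ (leq0n _); rewrite /= subn0.
    by apply=> //; lia.
  - move=> rho Sr _ /andP[r0 rj]; apply: lk => //.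
    by move: (size rho) r0 rj le => m; clear; lia.
have [j0|j_gt0] := posnP j.
  by exists 0 => //; rewrite j0; apply: uniformly_exact_0; rewrite addn1.
have [j1|j_neq1] := eqVneq j 1%N.
  by exists 1 => //; rewrite j1; apply: uniformly_exact_1; lia.
exists (1 + link_const Cl j j * (1 + j%:R * 1)).
  by rewrite addr_ge0 // mulr_ge0 ?link_const_ge0 // addr_ge0 // mulr_ge0.
move=> B B' tau BB _ /size0nil->.
pose D : 'M[R]_(n + 1, n) := col_mx 1%:M 0.
pose c := (row_mx 0 1%:M : 'rV[R]_(n + 1)) *m B'.
pose e : 'cV[R]_N := B *m col_mx 0 1%:M.
have cB : c *m (B *m D) = 0.
  by rewrite /c -mulmxA (mulmxA B') BB mul1mx mul_row_col mul0mx mulmx0 addr0.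
have ce : rowfun c e = 1.
  by rewrite /rowfun /c /e -mulmxA (mulmxA B') BB mul1mx mul_row_col mul0mx add0r mul1mx mxE eqxx.
have CBD : (row_mx 1%:M 0 *m B') *m (B *m D) = 1%:M.
  by rewrite -mulmxA (mulmxA B') BB mul1mx mul_row_col mul1mx mul0mx addr0.
have cone t : all (in_span (B *m D)) t -> link_in B [::] t -> link_in B [::] (e :: t).
  move=> aD [a u]; split; first by rewrite /= a andbT; apply/asboolP; exists (col_mx 0 1%:M).
  move: u; rewrite !cats0 => u; apply/(ulist_proj _ (covec_row c) ce).
  rewrite (_ : map _ _ = t) //; rewrite -[RHS]map_id; apply/eq_in_map => x.
  move=> /(allP aD) /asboolP[y ->].
  by rewrite /proj_along /rowfun mulmxA cB mul0mx mxE raddf0 mulmx0 subr0.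
apply: link_exact => //.
- exact: link_in_down.
- exact: link_in_perm.
- move=> f M M0 af bf cf; exists (slice e f); split.
  + exact: alternating_slice.
  + move=> t St at_ st; rewrite mul1r /slice; exact: (bf (e :: t) (cone t at_ St) st).
  move=> t St at_ st; have := cf (e :: t) (cone t at_ St); rewrite /= st => /(_ erefl).
  by rewrite cobd_cons => /eqP; rewrite subr_eq0 => /eqP.
move=> rho [ar ur] _ /andP[r0 rj].
have ln : (s + (2 * (j - size rho) - 1) + (0.-1 + size rho) <= n)%N 
  by move: (size rho) r0 rj le j_neq1 => m; clear; lia.
have ur' : ulist rho by rewrite cats0 in ur.
apply: exact_at_iff (links _ rj ln _ _ rho CBD ur' erefl) => w.
rewrite /link_in cats0; split=> [[aw uw]|[aw [_ uw]]]; split=> //.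
  by split; [rewrite all_cat ar (sub_span aw) | apply: ulist_perm uw; rewrite perm_catC].
by apply: ulist_perm uw; rewrite perm_catC.
Qed.

End UnimodularExact.

(** * Invariant means on abelian groups *)

Section Means.
Variable K : realType.

Definition bounded_by T (M : K) (f : T -> K) := forall x, `|f x| <= M.

(** Finitely additive probability measures concentrated on [P]. *)
Record mean_on T (P : T -> Prop) (m : (T -> K) -> K) : Prop := MeanOn {
  mean_sub : forall f g M, bounded_by M f -> bounded_by M g ->
    m (fun x => f x - g x) = m f - m g;
  mean_const : forall c, m (fun=> c) = c;
  mean_le : forall f M, bounded_by M f -> `|m f| <= M;
  mean_eq : forall f g, (forall x, P x -> f x = g x) -> m f = m g
}.

Section UltraLimit.
Variables (I : Type) (U : set_system I).
Hypothesis UU : UltraFilter U.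

Definition ulim_to (u : I -> K) (l : K) :=
  forall e, 0 < e -> U [set i | `|u i - l| < e]%classic.

Lemma ulim_unique u l l' : ulim_to u l -> ulim_to u l' -> l = l'.
Proof.
move=> ul ul'; apply/eqP; rewrite -subr_eq0; apply/negPn/negP => ne.
have e0 : 0 < `|l - l'| / 2 by rewrite divr_gt0 ?normr_gt0.
have [i [/= a b]] := filter_ex (filterI (ul _ e0) (ul' _ e0)).
have : `|l - l'| <= `|u i - l| + `|u i - l'|.
  rewrite (distrC (u i) l) (le_trans _ (ler_normD _ _)) // addrA subrK.
  by [].
lra.
Qed.

Lemma ulim_ex u M : U [set i | `|u i| <= M]%classic -> exists l, ulim_to u l.
Proof.
move=> bu; pose E := [set x | U [set i | x <= u i]]%classic.
have EM : E (- M).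
  by apply: filterS bu => i /=; rewrite ler_norml => /andP[].
have ubE : ubound E M.
  move=> x Ex; have [i [/= a b]] := filter_ex (filterI bu Ex).
  by move: a; rewrite ler_norml => /andP[_]; exact: le_trans.
have hsE : has_sup E by split; [exists (- M) | exists M].
exists (sup E) => e e0.
have [x Ex lx] := sup_adherent e0 hsE.
have nE : ~ E (sup E + e).
  move=> h; have := ub_le_sup hsE.2 h; rewrite gerDl; lra.
have [//|c] := in_ultra_setVsetC [set i | sup E + e <= u i]%classic UU.
apply: filterS (filterI Ex c) => i /= [a /negP]; rewrite -ltNge => b.
by rewrite ltr_norml; apply/andP; split; lra.
Qed.

End UltraLimit.

Lemma norm_sum_ord_le n (F : 'I_n -> K) M :
  (forall i, `|F i| <= M) -> `|\sum_(i < n) F i| <= n%:R * M.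
Proof.
move=> b; rewrite (le_trans (ler_norm_sum _ _ _)) //.
have -> : n%:R * M = \sum_(i < n) M by rewrite sumr_const card_ord mulr_natl.
by apply: ler_sum => i _; exact: b.
Qed.

Variables (W : zmodType) (S : W -> Prop).
Hypotheses (S0 : S 0) (SD : forall a b, S a -> S b -> S (a + b)).

Fixpoint avg (n : nat) (L : seq W) (f : W -> K) (y : W) : K :=
  if L is a :: L' then n.+1%:R^-1 * \sum_(k < n.+1) avg n L' f (y + a *+ k)
  else f y.

Let SL (L : seq W) := forall a, a \in L -> S a.

Let SMn a k : S a -> S (a *+ k).
Proof. by move=> Sa; elim: k => [|k IH]; rewrite ?mulr0n // mulrS; exact: SD. Qed.

Let SL_cons a L : SL (a :: L) -> S a /\ SL L.
Proof.
by move=> h; split=> [|b bL]; apply: h; rewrite inE ?eqxx // bL orbT.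
Qed.

Lemma avg_sub n L f g y :
  avg n L (fun x => f x - g x) y = avg n L f y - avg n L g y.
Proof.
elim: L y => //= a L IH y; rewrite -mulrBr -sumrB; congr (_ * _).
by apply: eq_bigr => k _.
Qed.

Lemma avg_const n L c y : avg n L (fun=> c) y = c.
Proof.
elim: L y => //= a L IH y; rewrite (eq_bigr (fun=> c)) // sumr_const card_ord.
by rewrite -[c *+ _]mulr_natl mulrA mulVf ?mul1r // pnatr_eq0.
Qed.

Lemma avg_eq n L f g y : SL L -> S y -> (forall x, S x -> f x = g x) ->
  avg n L f y = avg n L g y.
Proof.
move=> + + e; elim: L y => [|a L IH] y; first by move=> _; exact: e.
move=> /SL_cons[Sa SLL] Sy /=; congr (_ * _); apply: eq_bigr => k _.
by apply: IH => //; exact/SD/SMn.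
Qed.

Lemma avg_le n L f M y : bounded_by M f -> `|avg n L f y| <= M.
Proof.
move=> b; elim: L y => [|a L IH] y /=; first exact: b.
rewrite normrM ger0_norm ?invr_ge0 // ler_pdivrMl //.
by apply: norm_sum_ord_le => k; exact: IH.
Qed.

Lemma avg_shift n L f a y : avg n L (fun x => f (x + a)) y = avg n L f (y + a).
Proof.
elim: L y => //= b L IH y; congr (_ * _); apply: eq_bigr => k _.
by rewrite IH addrAC.
Qed.

(** Shifting an average over [n + 1] consecutive multiples of [a] by [a] changes
    only two of its terms. *)
Lemma avg_almost_invariant n L f a M y : bounded_by M f -> a \in L ->
  `|avg n L (fun x => f (x + a)) y - avg n L f y| <= n.+1%:R^-1 * (M + M).
Proof.
move=> b; rewrite avg_shift; elim: L y => // c L IH y.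
rewrite inE => /orP[/eqP<-|aL] /=; rewrite -mulrBr normrM ger0_norm ?invr_ge0 //.
  rewrite ler_wpM2l ?invr_ge0 //.
  have -> : \sum_(k < n.+1) avg n L f (y + a + a *+ k) =
      \sum_(k < n.+1) avg n L f (y + a *+ k.+1).
    by apply: eq_bigr => k _; rewrite mulrS addrA.
  rewrite big_ord_recr [X in _ - X]big_ord_recl /= mulr0n addr0.
  set z := avg _ _ _ (y + _ *+ n.+1); set w := avg _ _ _ y.
  set A := \sum_(i < n) _.
  have -> : A + z - (w + A) = z - w by ring.
  by rewrite (le_trans (ler_normB _ _)) // lerD // avg_le.
rewrite -sumrB ler_pdivrMl //; apply: norm_sum_ord_le => k.
by rewrite addrAC; exact: IH.
Qed.

(** The averages over larger and larger boxes are almost invariant, so their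
    limit along an ultrafilter is invariant. *)
Lemma invariant_mean : exists2 m, mean_on S m &
  forall f M a, bounded_by M f -> S a -> m (fun x => f (x + a)) = m f.
Proof.
pose F : set_system (seq W * nat) := fun A => exists L n0, SL L /\
  forall L' n, SL L' -> {subset L <= L'} -> (n0 <= n)%N -> A (L', n).
have FF : ProperFilter F.
  apply: Build_ProperFilter_ex.
    move=> A [L [n0 [SLL h]]]; exists (L, n0); exact: h.
  split.
  - by exists [::], 0%N; split.
  - move=> A B [L [n [SLL h]]] [L' [n' [SLL' h']]].
    exists (L ++ L'), (maxn n n'); split.
      by move=> a; rewrite mem_cat => /orP[/SLL|/SLL'].
    move=> L2 n2 SL2 sub; rewrite geq_max => /andP[l l'].
    split; [apply: h | apply: h'] => // a aL; apply: sub; rewrite mem_cat aL ?orbT //.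
  - move=> A B AB [L [n [SLL h]]]; exists L, n; split=> // L' n' *.
    by apply: AB; apply: h.
have [U [UU FU]] := ultraFilterLemma FF.
pose mu (f : W -> K) (i : seq W * nat) := avg i.2 i.1 f 0.
have USL : U [set i | SL i.1]%classic.
  by apply: FU; exists [::], 0%N; split.
pose m f := if pselect (exists l, ulim_to U (mu f) l) is left ex
            then projT1 (cid ex) else 0.
have mP f l : ulim_to U (mu f) l -> m f = l.
  move=> ul; rewrite /m; case: pselect => [ex|[]]; last by exists l.
  by case: cid => l' ul' /=; exact: ulim_unique ul' ul.
have mlim f M : bounded_by M f -> ulim_to U (mu f) (m f).
  move=> b; have [|l ul] := @ulim_ex _ _ UU (mu f) M.
    by apply: filterS USL => i _ /=; exact: avg_le.
  by rewrite (mP _ _ ul).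
exists m.
  split.
  - move=> f g M bf bg; apply: mP => e e0.
    have e2 : 0 < e / 2 by rewrite divr_gt0.
    apply: filterS (filterI (mlim _ _ bf _ e2) (mlim _ _ bg _ e2)) => i /= [a b].
    rewrite /mu avg_sub -/(mu f i) -/(mu g i).
    have -> : mu f i - mu g i - (m f - m g) = (mu f i - m f) - (mu g i - m g).
      by ring.
    by rewrite (le_lt_trans (ler_normB _ _)) // [e]splitr ltrD.
  - move=> c; apply: mP => e e0; apply: filterS USL => i _ /=.
    by rewrite /mu avg_const subrr normr0.
  - move=> f M b; rewrite leNgt; apply/negP => ltM.
    have e0 : 0 < `|m f| - M by rewrite subr_gt0.
    have [i /= h] := filter_ex (mlim _ _ b _ e0).
    have := avg_le i.2 i.1 0 b; rewrite -/(mu f i) => bi.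
    have : `|m f| <= `|mu f i| + `|mu f i - m f|.
      by rewrite -{1}[m f](subrK (mu f i)) addrC (le_trans (ler_normD _ _)) // distrC.
    lra.
  - move=> f g e; rewrite /m (_ : ulim_to U (mu f) = ulim_to U (mu g)) //.
    apply/funext => l; apply/propext; split=> h e' e0;
      apply: filterS (filterI USL (h _ e0)) => i /= [SLi];
      by rewrite /mu (avg_eq _ SLi S0 e).
move=> f M a b Sa; apply: mP => e e0.
have e2 : 0 < e / 2 by rewrite divr_gt0.
have M0 : 0 <= M by exact: le_trans (normr_ge0 _) (b 0).
pose n0 := Num.bound ((M + M) / (e / 2)).
have US : U [set i | `|mu (fun x => f (x + a)) i - mu f i| < e / 2]%classic.
  apply: FU; exists [:: a], n0; split.
    by move=> c; rewrite inE => /eqP->.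
  move=> L n SLL sub ln /=; rewrite /mu /=.
  have aL : a \in L by apply: sub; rewrite inE.
  apply: le_lt_trans (avg_almost_invariant n 0 b aL) _.
  rewrite ltr_pdivrMl // -ltr_pdivrMr //.
  apply: lt_le_trans (archi_boundP _) _.
    by rewrite divr_ge0 ?addr_ge0 // ltW.
  by rewrite ler_nat leqW.
apply: filterS (filterI US (mlim _ _ b _ e2)) => i /= [h1 h2].
have : `|mu (fun x => f (x + a)) i - m f| <=
    `|mu (fun x => f (x + a)) i - mu f i| + `|mu f i - m f|.
  by rewrite (le_trans _ (ler_normD _ _)) // addrA subrK.
lra.
Qed.

End Means.

(** * Averaging group cochains *)

Section Averaging.
Variables (K : realType) (G : groupType).
Implicit Types (F : seq G -> K) (s : seq G).

Definition lbounded F := forall n, exists M, forall s, size s = n -> `|F s| <= M.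

Lemma lbounded_slice g F : lbounded F -> lbounded (slice g F).
Proof. by move=> b n; have [M h] := b n.+1; exists M => s sn; apply: h; rewrite /= sn. Qed.

Lemma lbounded_cobd F : lbounded F -> lbounded (cobd F).
Proof.
move=> b [|n]; first by exists 0 => s /size0nil->; rewrite normr0.
have [M h] := b n; exists (n.+1%:R * M) => s sn; rewrite -sn.
apply: (@cobd_bound _ _ (fun=> True)) => // u _; rewrite sn => -[]; exact: h.
Qed.

(** Each entry [g] is multiplied on the right by an element drawn independently
    from the mean [nu g].  Right multiplication commutes with left translation,
    so invariance under the group is preserved as soon as the family [nu] is
    equivariant. *)
Fixpoint av (nu : G -> (G -> K) -> K) F s : K :=
  if s is g :: u then nu g (fun b => av nu (slice (g * b)%g F) u) else F [::].

Fixpoint prism (nu : G -> (G -> K) -> K) F s : K :=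
  if s is g :: u then av nu (slice g F) (g :: u) - prism nu (slice g F) u else 0.

Variable nu : G -> (G -> K) -> K.
Hypothesis nuP : forall g, mean_on (fun=> True) (nu g).

Lemma av_le F s M : (forall u, size u = size s -> `|F u| <= M) -> `|av nu F s| <= M.
Proof.
elim: s F => [|g s IH] F b /=; first exact: b.
by apply: (mean_le (nuP g)) => x; apply: IH => u us; apply: b; rewrite /= us.
Qed.

Lemma av_arg_bounded F s g : lbounded F ->
  exists M, bounded_by M (fun b => av nu (slice (g * b)%g F) s).
Proof.
move=> bF; have [M h] := bF (size s).+1; exists M => b.
by apply: av_le => u us; apply: h; rewrite /= us.
Qed.

Lemma mean_subW g f f' : (exists M, bounded_by M f) -> (exists M, bounded_by M f') ->
  nu g (fun x => f x - f' x) = nu g f - nu g f'.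
Proof.
move=> [M b] [M' b']; apply: (@mean_sub _ _ _ _ (nuP g) _ _ (Num.max M M')) => x;
  by rewrite le_max ?b ?b' ?orbT.
Qed.

Lemma av_sub F F' s : lbounded F -> lbounded F' ->
  av nu (fun u => F u - F' u) s = av nu F s - av nu F' s.
Proof.
elim: s F F' => //= g s IH F F' b b'; rewrite -mean_subW; try exact: av_arg_bounded.
by congr nu; apply/funext => x; rewrite -IH //; exact: lbounded_slice.
Qed.

Lemma mean_cobd g (H : G -> seq G -> K) s :
  (forall n, exists M, forall b u, size u = n -> `|H b u| <= M) ->
  nu g (fun b => cobd (H b) s) = cobd (fun u => nu g (fun b => H b u)) s.
Proof.
elim: s H => [|x s IH] H bH; first exact: (mean_const (nuP g)).
under eq_fun do rewrite cobd_cons.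
rewrite cobd_cons mean_subW.
- rewrite (IH (fun b => slice x (H b))) // => n.
  by have [M h] := bH n.+1; exists M => b u un; apply: h; rewrite /= un.
- by have [M h] := bH (size s); exists M => b; exact: h.
have [M h] := bH (size s); exists ((size s)%:R * M) => b.
apply: (@cobd_bound _ _ (fun=> True)) => // u _ us.
by apply: h.
Qed.

Lemma slice_cobd g F : slice g (cobd F) = fun s => F s - cobd (slice g F) s.
Proof. by apply/funext => s; rewrite /slice cobd_cons. Qed.

Lemma av_cobd F s : lbounded F -> av nu (cobd F) s = cobd (av nu F) s.
Proof.
elim: s F => // g s IH F bF; rewrite cobd_cons /=.
have -> : (fun b => av nu (slice (g * b)%g (cobd F)) s) =
    (fun b => av nu F s - cobd (av nu (slice (g * b)%g F)) s).
  apply/funext => b; rewrite slice_cobd av_sub //.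
    by rewrite IH //; exact: lbounded_slice.
  exact/lbounded_cobd/lbounded_slice.
have bH n : exists M, forall (b : G) u, size u = n -> `|av nu (slice (g * b)%g F) u| <= M.
  have [M h] := bF n.+1; exists M => b u un; apply: av_le => u' us; apply: h.
  by rewrite /= us un.
rewrite mean_subW ?mean_cobd //.
- by rewrite (mean_const (nuP g)).
- by have [M h] := bF (size s); exists M => b; exact: av_le.
case: s {IH} => [|x s]; first by exists 0 => b; rewrite normr0.
have [M h] := bH (size s); exists ((size s).+1%:R * M) => b.
by apply: (@cobd_bound _ _ (fun=> True)) => // u _ [us]; exact: h.
Qed.

Lemma prism_le F s M : 0 <= M ->
  (forall u, size u = (size s).+1 -> `|F u| <= M) -> `|prism nu F s| <= (size s)%:R * M.
Proof.
move=> M0; elim: s F => [|g s IH] F b; first by rewrite normr0 mul0r.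
rewrite [size _]/= -natr1 mulrDl mul1r addrC.
rewrite -[prism nu F (g :: s)]/(av nu (slice g F) (g :: s) - prism nu (slice g F) s).
rewrite (le_trans (ler_normB _ _)) // lerD //.
  by apply: av_le => u us; apply: b; rewrite /= us.
by apply: IH => u us; apply: b; rewrite /= us.
Qed.

Lemma prism_sub F F' s : lbounded F -> lbounded F' ->
  prism nu (fun u => F u - F' u) s = prism nu F s - prism nu F' s.
Proof.
elim: s F F' => [|g s IH] F F' b b'; first by rewrite subrr.
have := IH (slice g F) (slice g F') (lbounded_slice g b) (lbounded_slice g b').
have := @av_sub (slice g F) (slice g F') (g :: s) (lbounded_slice g b) (lbounded_slice g b').
move=> e1 e2; rewrite -[LHS]/(av nu (fun u => slice g F u - slice g F' u) (g :: s) -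
  prism nu (fun u => slice g F u - slice g F' u) s) e1 e2.
rewrite -[prism nu F _]/(av nu (slice g F) (g :: s) - prism nu (slice g F) s).
rewrite -[prism nu F' _]/(av nu (slice g F') (g :: s) - prism nu (slice g F') s).
by rewrite !opprD !opprK addrACA.
Qed.

(** The random translates of a list span prisms with it, which give a homotopy
    from the identity to the averaging operator. *)
Lemma prism_homotopy F s : lbounded F ->
  cobd (prism nu F) s + prism nu (cobd F) s = av nu F s - F s.
Proof.
elim: s F => [|g s IH] F bF; first by rewrite /= /cobd /= subrr addr0.
have bS := lbounded_slice g bF.
rewrite cobd_cons.
have -> : cobd (slice g (prism nu F)) s =
    cobd (fun u => av nu (slice g F) (g :: u)) s - cobd (prism nu (slice g F)) s.
  by rewrite -cobdB.
rewrite -[prism nu (cobd F) _]/(av nu (slice g (cobd F)) (g :: s) -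
  prism nu (slice g (cobd F)) s).
rewrite slice_cobd av_sub //; last exact: lbounded_cobd.
rewrite prism_sub //; last exact: lbounded_cobd.
rewrite (av_cobd _ bS) cobd_cons.
have := IH _ bS.
rewrite -[cobd (slice g (av nu (slice g F))) s]/(cobd (fun u => av nu (slice g F) (g :: u)) s).
rewrite -[slice g F s]/(F (g :: s)).
move: (cobd _ _) (prism _ _ _) (av _ _ _) (cobd _ _) (prism _ _ _) (av _ _ _) => *.
lra.
Qed.

Lemma av_homotopy F s : lbounded F ->
  (forall u, size u = (size s).+1 -> cobd F u = 0) ->
  av nu F s = F s + cobd (prism nu F) s.
Proof.
move=> bF cF; have := prism_homotopy s bF.
have : `|prism nu (cobd F) s| <= (size s)%:R * 0.
  by apply: prism_le => // u us; rewrite cF // normr0.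
by rewrite mulr0 normr_le0 => /eqP->; rewrite addr0 => ->; rewrite addrC subrK.
Qed.

End Averaging.

Definition lmul (G : groupType) (h : G) : G -> G := fun g => (h * g)%g.

Lemma lmul_cancel (G : groupType) (h g k : G) :
  lmul (lmul h g)^-1 (lmul h k) = lmul g^-1 k.
Proof. by rewrite /lmul invgM -mulgA mulKg. Qed.

Section AveragingEquivariance.
Variables (K : realType) (G : groupType).
Implicit Types (F : seq G -> K) (s : seq G) (nu : G -> (G -> K) -> K).

Lemma av_map nu nu' (h : G) F s : (forall g, nu' (h * g)%g = nu g) ->
  av nu' F (map (lmul h) s) = av nu (fun u => F (map (lmul h) u)) s.
Proof.
move=> e; elim: s F => //= g s IH F; rewrite [nu' _]e; congr nu; apply/funext => b.
by rewrite IH /slice /= /lmul mulgA.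
Qed.

Lemma prism_map nu nu' (h : G) F s : (forall g, nu' (h * g)%g = nu g) ->
  prism nu' F (map (lmul h) s) =
  prism nu (fun u => F (map (lmul h) u)) s.
Proof.
move=> e; elim: s F => // g s IH F.
rewrite -[LHS]/(av nu' (slice (h * g)%g F) (map (lmul h) (g :: s)) -
   prism nu' (slice (h * g)%g F) (map (lmul h) s)).
by rewrite (av_map _ _ e) IH.
Qed.

Definition dirac (k : G) (f : G -> K) : K := f k.

Lemma dirac_mean k : mean_on (fun=> True) (dirac k).
Proof. by split=> // f g e; rewrite /dirac e. Qed.

Lemma av_dirac (k : G -> G) F s :
  av (fun g => dirac (k g)) F s = F (map (fun g => g * k g)%g s).
Proof. by elim: s F => //= g s IH F; rewrite /dirac IH. Qed.

End AveragingEquivariance.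

(** * The double complex of a general linear group *)

Section GLFacts.
Variables (R : pzRingType) (N : nat).
Implicit Types (g h k : GL R N) (u v x : 'cV[R]_N) (r t : seq 'cV[R]_N).

Lemma GL_mulE g h x : (g * h)%g x = g (h x).
Proof. by []. Qed.

Lemma GL_invK g : cancel g (g^-1)%g.
Proof. by move=> x; rewrite -GL_mulE mulVg. Qed.

Lemma GL_Kinv g : cancel (g^-1)%g g.
Proof. by move=> x; rewrite -GL_mulE mulgV. Qed.

Lemma map_GL_mul g h t : map (g * h)%g t = map g (map h t).
Proof. by rewrite -map_comp. Qed.

Lemma map_GL_invK g t : map (g^-1)%g (map g t) = t.
Proof. by rewrite mapK //; exact: GL_invK. Qed.

Lemma scalar_colN u (a : R) : u *m (- a)%:M = - (u *m a%:M).
Proof. by rewrite raddfN mulmxN. Qed.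

Lemma scalar_colD u (a b : R) : u *m (a + b)%:M = u *m a%:M + u *m b%:M.
Proof. by rewrite raddfD mulmxDr. Qed.

Lemma map_GL_cancel g h t : map (lmul h g)^-1%g (map h t) = map g^-1%g t.
Proof. by rewrite -map_GL_mul /lmul invgM -mulgA mulVg mulg1. Qed.

Lemma GL_sub g u v : g (u - v) = g u - g v.
Proof.
have [gD gZ] := GL_linear g; rewrite gD; congr (_ + _).
by have := gZ v (-1); rewrite !scalar_colN !mulmx1.
Qed.

Lemma GL_scale g u a : g (u *m a%:M) = g u *m a%:M.
Proof. by have [_ ->] := GL_linear g. Qed.

Lemma ulist_map g t : ulist t -> ulist (map g t).
Proof.
move=> u x r p.
have := perm_map (g^-1)%g p; rewrite map_GL_invK /= => p'.
have [phi [cp p1 p0]] := u _ _ p'.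
exists (phi \o (g^-1)%g); split=> //; first exact/covec_comp/GL_linear.
by move=> y yr /=; apply: p0; exact: map_f.
Qed.

Definition mkGL (f : 'cV[R]_N -> 'cV[R]_N) : GL R N :=
  if pselect (right_linear f /\ bijective f) is left h
  then MkGL (proj1 h) (proj2 h) else 1%g.

Lemma mkGLE f : right_linear f -> bijective f -> mkGL f =1 f.
Proof. by move=> lf bf x; rewrite /mkGL; case: pselect => // -[]. Qed.

Lemma transvectionE u alpha : covec alpha -> alpha u = 0 ->
  mkGL (proj_along u alpha) =1 proj_along u alpha.
Proof.
move=> ca au; apply: mkGLE; first exact: right_linear_proj.
exists (fun v => v + u *m (alpha v)%:M) => v; rewrite /proj_along.
  by rewrite covecB // (proj2 ca) au mul0r subr0 subrK.
by rewrite (proj1 ca) (proj2 ca) au mul0r addr0 addrK.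
Qed.

Lemma reflectionE u chi : covec chi -> chi u = 1 + 1 ->
  mkGL (proj_along u chi) =1 proj_along u chi.
Proof.
move=> cc cu; apply: mkGLE; first exact: right_linear_proj.
have K2 : cancel (proj_along u chi) (proj_along u chi).
  move=> v; rewrite /proj_along covecB // (proj2 cc) cu mulrDl mul1r.
  by rewrite opprD addrA subrr sub0r scalar_colN opprK subrK.
by exists (proj_along u chi).
Qed.

End GLFacts.

Section DoubleComplex.
Variables (K : realType) (R : pzRingType) (N : nat).
Implicit Types (g h k : GL R N) (u v x : 'cV[R]_N) (r t : seq 'cV[R]_N).
Implicit Types (s : seq (GL R N)) (H : seq (GL R N) -> seq 'cV[R]_N -> K).

(** The entry of the double complex with [a] group elements and [b] vectors.  For
    [b = 0] these are the homogeneous cochains of the group, for [a = 0] the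
    invariant cochains on partial bases. *)
Record bicochain (a b : nat) H : Prop := Bicochain {
  bic_inv : forall h s t, H (map (lmul h) s) (map h t) = H s t;
  bic_alt : forall s, alternating (H s);
  bic_bound : exists2 M, 0 <= M & forall s t, size s = a -> size t = b ->
    ulist t -> `|H s t| <= M
}.

Lemma ulist_down_closed : down_closed (@ulist R N).
Proof. by move=> s1 x s2; exact: ulist_down. Qed.

Lemma bic_sub a b H H' : bicochain a b H -> bicochain a b H' ->
  bicochain a b (fun s t => H s t - H' s t).
Proof.
move=> [i al [M M0 bd]] [i' al' [M' M'0 bd']]; split.
- by move=> h s t; rewrite i i'.
- by move=> s s1 x y s2; rewrite al al'; ring.
exists (M + M'); first exact: addr_ge0.
by move=> s t sa tb ut; rewrite (le_trans (ler_normB _ _)) // lerD ?bd ?bd'.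
Qed.

Lemma bic_zero a b : bicochain a b (fun _ _ => 0).
Proof.
split=> //; first by move=> s s1 x y s2; rewrite oppr0.
by exists 0 => // *; rewrite normr0.
Qed.

Lemma bic_cobd1 a b H : bicochain a b H ->
  bicochain a.+1 b (fun s t => cobd (H^~ t) s).
Proof.
move=> [i al [M M0 bd]]; split.
- by move=> h s t; rewrite cobd_map; apply: eq_cobd => u; rewrite i.
- move=> s s1 x y s2; rewrite -mulN1r -cobdZ; apply: eq_cobd => u.
  by rewrite al mulN1r.
exists (a.+1%:R * M); first exact: mulr_ge0.
move=> s t sa tb ut; rewrite -sa; apply: (@cobd_bound _ _ (fun=> True)) => // u _.
by rewrite sa => -[us]; exact: bd.
Qed.

Lemma bic_cobd2 a b H : bicochain a b H ->
  bicochain a b.+1 (fun s t => cobd (H s) t).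
Proof.
move=> [i al [M M0 bd]]; split.
- by move=> h s t; rewrite cobd_map; apply: eq_cobd => u; rewrite i.
- by move=> s; exact: alternating_cobd.
exists (b.+1%:R * M); first exact: mulr_ge0.
move=> s t sa tb ut; rewrite -tb.
apply: (cobd_bound ulist_down_closed) => // u uu.
by rewrite tb => -[us]; exact: bd.
Qed.

(** Invariant cochains are determined by their values on lists starting with the
    identity, where no invariance condition is left. *)
Lemma row_exact (C : K) a b H : bicochain a.+1 b.+1 H -> 0 <= C ->
  exact_at C (@ulist R N) b.+1 ->
  (forall s t, size s = a.+1 -> size t = b.+2 -> ulist t -> cobd (H s) t = 0) ->
  exists2 H', bicochain a.+1 b H' &
    forall s t, size s = a.+1 -> size t = b.+1 -> ulist t -> H s t = cobd (H' s) t.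
Proof.
move=> [i al [M M0 bd]] C0 ex cl.
have /choice[f fP] s : exists f, alternating f /\ (size s = a.+1 ->
    (forall t, ulist t -> size t = b -> `|f t| <= C * M) /\
    (forall t, ulist t -> size t = b.+1 -> H s t = cobd f t)).
  have [sa|sa] := pselect (size s = a.+1); last first.
    by exists (fun=> 0); split=> // ????; rewrite oppr0.
  have [||f [af bf ef]] := ex (H s) M M0 (al s).
  - by move=> t ut tb; exact: bd.
  - by move=> t ut tb; exact: cl.
  by exists f; split=> // _; split=> // t ut tb; apply: bf => //; rewrite tb.
pose H' s t := if s is g :: _ then f (map (lmul g^-1) s) (map (g^-1)%g t) else 0.
exists H'.
  split.
  - move=> h [|g s] t  //.
    rewrite -[LHS]/(f (map (lmul (lmul h g)^-1%g) (map (lmul h) (g :: s)))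
      (map (lmul h g)^-1%g (map h t))) map_GL_cancel -map_comp.
    by congr (f _ _); apply: eq_map => k; exact: lmul_cancel.
  - move=> [|g s]; first by move=> ????; rewrite oppr0.
    by move=> s1 x y s2; rewrite /H' !map_cat /=; have [-> _] := fP (map (lmul g^-1) (g :: s)).
  - exists (C * M); first exact: mulr_ge0.
    move=> [|g s] t // sa tb ut; rewrite /H'.
    have [_ []] := fP (map (lmul g^-1) (g :: s)); first by rewrite size_map.
    by move=> bf _; apply: bf; rewrite ?size_map //; exact: ulist_map.
move=> [|g s] t // sa tb ut.
have [_ []] := fP (map (lmul g^-1) (g :: s)); first by rewrite size_map.
move=> _ ef; rewrite -(i (g^-1)%g) ef ?size_map //; last exact: ulist_map.
by rewrite cobd_map.
Qed.

End DoubleComplex.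

Lemma mean_push (K : realType) (A B : Type) (P : A -> Prop) m (phi : A -> B) :
  @mean_on K A P m -> mean_on (fun=> True) (fun f => m (fun a => f (phi a))).
Proof.
move=> mP; split.
- move=> f g M bf bg; apply: (mean_sub mP (M := M)) => x; [exact: bf | exact: bg].
- by move=> c; exact: (mean_const mP).
- by move=> f M bf; apply: (mean_le mP) => x; exact: bf.
- by move=> f g e; apply: (mean_eq mP) => x _; exact: e.
Qed.

Section Vanishing.
Variables (K : realType) (R : pzRingType) (N : nat).
Implicit Types (g h k : GL R N) (u v x y : 'cV[R]_N) (r t : seq 'cV[R]_N).
Implicit Types (s : seq (GL R N)) (H : seq (GL R N) -> seq 'cV[R]_N -> K).
Implicit Types (alpha chi : 'cV[R]_N -> R).

Definition ann t alpha := covec alpha /\ forall z, z \in t -> alpha z = 0.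

Lemma ann0 t : ann t 0.
Proof. by split=> //; split=> *; rewrite ?addr0 ?mul0r. Qed.

Lemma annD t alpha chi : ann t alpha -> ann t chi -> ann t (alpha + chi).
Proof.
move=> [c0 z0] [c1 z1]; split; first exact: covec_add.
by move=> z zt; rewrite -[LHS]/(alpha z + chi z) z0 // z1 // addr0.
Qed.

Definition ann_mean t : (('cV[R]_N -> R) -> K) -> K :=
  projT1 (cid2 (invariant_mean K (ann0 t) (@annD t))).

Lemma ann_meanP t : mean_on (ann t) (ann_mean t).
Proof. by rewrite /ann_mean; case: cid2. Qed.

Lemma ann_mean_shift t f M alpha : bounded_by M f -> ann t alpha ->
  ann_mean t (fun a => f (a + alpha)) = ann_mean t f.
Proof. by rewrite /ann_mean; case: cid2 => m mP mi /=; exact: mi. Qed.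

Definition exchange t := if t is x :: y :: r then y :: x :: r else t.

Definition gap t := if t is x :: y :: r then x - y else 0.

Lemma exchangeK t : exchange (exchange t) = t.
Proof. by case: t => [|x [|y r]]. Qed.

Lemma gap_exchange t : gap (exchange t) = - gap t.
Proof. by case: t => [|x [|y r]] /=; rewrite ?oppr0 // opprB. Qed.

Lemma exchange_map g t : exchange (map g t) = map g (exchange t).
Proof. by case: t => [|x [|y r]]. Qed.

Lemma gap_map g t : gap (map g t) = g (gap t).
Proof.
have g0 : g 0 = 0 by have := GL_sub g 0 0; rewrite subr0 subrr.
by case: t => [|x [|y r]] //=; rewrite GL_sub.
Qed.

Lemma perm_exchange t : perm_eq t (exchange t).
Proof. by case: t => [|x [|y r]] //=; exact: perm_swap. Qed.

Lemma alternating_exchange (f : seq 'cV[R]_N -> K) t : alternating f -> (1 < size t)%N ->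
  f (exchange t) = - f t.
Proof. by case: t => [|x [|y r]] // af _; exact: (af [::]). Qed.

(** For such [chi] the reflection [v - (x - y) chi v] exchanges the first two
    vectors [x] and [y] and fixes the others. *)
Definition separates t chi := if t is x :: y :: r then
  [/\ covec chi, chi x = 1, chi y = - 1 & forall z, z \in r -> chi z = 0] else False.

Lemma separates_ex t : ulist t -> (1 < size t)%N -> exists chi, separates t chi.
Proof.
case: t => [|x [|y r]] // u _.
have [phi [cp p1 p0]] := u x (y :: r) (perm_refl _).
have [psi [cq q1 q0]] := u y (x :: r) (perm_swap _ _ _).
exists (fun z => phi z - psi z); split.
- exact: covec_sub.
- by rewrite p1 q0 ?mem_head // subr0.
- by rewrite q1 p0 ?mem_head // sub0r.
by move=> z zr; rewrite p0 ?q0 ?subrr // inE zr orbT.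
Qed.

Lemma separates_gap t chi : separates t chi -> chi (gap t) = 1 + 1.
Proof. by case: t => [|x [|y r]] // [cc c1 c2 _]; rewrite /gap covecB // c1 c2 opprK. Qed.

Lemma separates_covec t chi : separates t chi -> covec chi.
Proof. by case: t => [|x [|y r]] // []. Qed.

Lemma separates_exchange t chi : separates t chi -> map (proj_along (gap t) chi) t = exchange t.
Proof.
case: t => [|x [|y r]] // [cc c1 c2 c0] /=; rewrite /proj_along c1 c2.
congr [:: _, _ & _].
- by rewrite mulmx1 opprB addrC subrK.
- by rewrite scalar_colN mulmx1 opprK addrC subrK.
rewrite -[RHS]map_id; apply/eq_in_map => z zr.
by rewrite c0 // raddf0 mulmx0 subr0.
Qed.

Lemma separates_comp g t chi : separates t chi -> separates (map g^-1%g t) (chi \o g).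
Proof.
case: t => [|x [|y r]] // [cc c1 c2 c0] /=; rewrite !GL_Kinv; split=> //.
  exact/covec_comp/GL_linear.
by move=> _ /mapP[w wr ->] /=; rewrite GL_Kinv c0.
Qed.

Lemma separates_sub t chi chi' : separates t chi -> separates t chi' ->
  ann t (fun v => chi v - chi' v).
Proof.
case: t => [|x [|y r]] // [cc c1 c2 c0] [cc' c1' c2' c0'].
split; first exact: covec_sub.
move=> z; rewrite !inE => /or3P[/eqP->|/eqP->|zr]; rewrite ?c1 ?c1' ?c2 ?c2' ?subrr //.
by rewrite c0 // c0' // subrr.
Qed.

Lemma separates_add t chi alpha : separates t chi -> ann t alpha ->
  separates t (fun v => chi v + alpha v).
Proof.
case: t => [|x [|y r]] // [cc c1 c2 c0] [ca a0]; split.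
- exact: covec_add.
- by rewrite c1 a0 ?addr0 // mem_head.
- by rewrite c2 a0 ?addr0 // !inE eqxx orbT.
by move=> z zr; rewrite c0 // a0 ?addr0 // !inE zr !orbT.
Qed.

Lemma ann_gap t alpha : ann t alpha -> alpha (gap t) = 0.
Proof.
case: t => [|x [|y r]] [ca a0]; rewrite /gap ?(covec0 ca) //.
by rewrite covecB // !a0 ?subrr // !inE eqxx ?orbT.
Qed.

Definition some_sep t : 'cV[R]_N -> R :=
  if pselect (exists chi, separates t chi) is left ex then projT1 (cid ex) else fun=> 0.

Lemma some_sepP t chi : separates t chi -> separates t (some_sep t).
Proof.
by move=> sc; rewrite /some_sep; case: pselect => [ex|[]]; [case: cid | exists chi].
Qed.

(** The law of a random reflection that exchanges the first two vectors: a fixed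
    covector plus a random element of the annihilator of the list. *)
Definition swap_law t (f : GL R N -> K) : K :=
  ann_mean t (fun alpha => f (mkGL (proj_along (gap t) (fun v => some_sep t v + alpha v)))).

(** The law of a random shear along the gap.  The mean is the one of the exchanged
    list so that this law at [exchange t] is built from the same mean as
    [swap_law] at [t]. *)
Definition shear_law t (f : GL R N -> K) : K :=
  ann_mean (exchange t) (fun alpha => f (mkGL (proj_along (gap t) alpha))).

Definition swap_laws t g := swap_law (map g^-1%g t).
Definition shear_laws t g := shear_law (map g^-1%g t).

Lemma swap_lawsP t g : mean_on (fun=> True) (swap_laws t g).
Proof.
exact: (mean_push (fun alpha => mkGL (proj_along _ (fun v => some_sep _ v + alpha v)))
  (ann_meanP _)).
Qed.

Lemma shear_lawsP t g : mean_on (fun=> True) (shear_laws t g).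
Proof. exact: (mean_push (fun alpha => mkGL (proj_along _ alpha)) (ann_meanP _)). Qed.

(** Composing a reflection that exchanges the first two vectors with a random
    one gives a random shear, by invariance of the mean: all the reflections
    differ by shears. *)
Lemma swap_shear t chi (c : GL R N) g (f : GL R N -> K) M : separates t chi ->
  c =1 proj_along (gap t) chi -> bounded_by M f ->
  swap_laws t g (fun b => f (c * g * b)%g) = shear_laws (exchange t) g (fun b => f (g * b)%g).
Proof.
move=> sc cE bf; rewrite /swap_laws /shear_laws -exchange_map.
set tau := map g^-1%g t; rewrite /swap_law /shear_law exchangeK gap_exchange.
have sc' : separates tau (chi \o g) by exact: separates_comp.
have s0 := some_sepP sc'; set chi0 := some_sep tau in s0 *.
pose beta v := chi0 v - (chi \o g) v.
have bA : ann tau beta by exact: separates_sub.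
pose F alpha := f (g * mkGL (proj_along (- gap tau) alpha))%g.
have bF : bounded_by M F by move=> alpha; exact: bf.
rewrite -[RHS](ann_mean_shift bF bA); apply: (mean_eq (ann_meanP tau)) => alpha aA.
rewrite /F; congr f; apply: GL_ext => v; rewrite !GL_mulE.
have sa := separates_add s0 aA.
have aB := annD aA bA.
have ca : covec (alpha + beta) by case: aB.
rewrite (reflectionE (separates_covec sa) (separates_gap sa)).
rewrite transvectionE //; last by rewrite covecN // ann_gap // oppr0.
have gE : gap t = g (gap tau) by rewrite /tau gap_map GL_Kinv.
rewrite cE /proj_along gE -GL_scale -GL_sub; congr (g _).
have -> : chi (g (v - gap tau *m (chi0 v + alpha v)%:M)) =
   (chi \o g) v - (1 + 1) * (chi0 v + alpha v).
  have cg := separates_covec sc'.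
  by rewrite -[LHS]/((chi \o g) _) (covecB _ _ cg) (proj2 cg) (separates_gap sc').
rewrite mulNmx opprK -[(alpha + beta) v]/(alpha v + (chi0 v - (chi \o g) v)).
move: (chi0 v) (alpha v) ((chi \o g) v) (gap tau) => p q w z.
rewrite -addrA; congr (v + _); rewrite -!scalar_colN -scalar_colD; congr (_ *m _%:M).
by rewrite opprB mulrDl mul1r -(addrA (p + q)) addKr [p + q]addrC addrA.
Qed.

Lemma av_swap_shear t chi (c : GL R N) (F : seq (GL R N) -> K) s :
  separates t chi -> c =1 proj_along (gap t) chi -> lbounded F ->
  av (swap_laws t) (fun w => F (map (lmul c) w)) s = av (shear_laws (exchange t)) F s.
Proof.
move=> sc cE; elim: s F => // g s IH F bF.
have [M bM] := av_arg_bounded (@shear_lawsP (exchange t)) s g bF.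
rewrite [RHS]/=.
pose f k := av (shear_laws (exchange t)) (slice k F) s.
have bf : bounded_by M (fun k => f (g * k)%g) by [].
have bf' : bounded_by M f by move=> k; rewrite -[k](mulVKg g); exact: bf.
rewrite -(swap_shear g sc cE bf') /=; congr (swap_laws _ _ _); apply/funext => b.
rewrite /f -IH; last exact: lbounded_slice.
by congr av; apply/funext => u; rewrite /slice /= /lmul mulgA.
Qed.

Lemma swap_laws_map t h g : swap_laws (map h t) (lmul h g) = swap_laws t g.
Proof. by rewrite /swap_laws map_GL_cancel. Qed.

Lemma shear_laws_map t h g : shear_laws (map h t) (lmul h g) = shear_laws t g.
Proof. by rewrite /shear_laws map_GL_cancel. Qed.

(** The exchange of the first two vectors of a list is realized by group elements,
    so up to averaging over the abelian group of shears it acts trivially on the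
    cohomology of the column of lists of that length.  It also changes the sign
    of alternating cochains, hence their classes vanish. *)
Lemma column_exact a b H : bicochain a b H -> (1 < b)%N ->
  (forall s t, size s = a.+1 -> size t = b -> ulist t -> cobd (H^~ t) s = 0) ->
  exists2 H', bicochain a.-1 b H' &
    forall s t, size s = a -> size t = b -> ulist t -> H s t = cobd (H'^~ t) s.
Proof.
move=> [i al [M M0 bd]] b2 cl.
pose dom t := size t = b /\ ulist t.
have dom_perm t t' : perm_eq t t' -> dom t -> dom t'.
  by move=> p [tb ut]; split; [rewrite -(perm_size p) | exact: ulist_perm ut].
have dom_map h t : dom (map h t) <-> dom t.
  split=> -[tb ut]; rewrite /dom size_map in tb *; split=> //; last exact: ulist_map.
  by rewrite -(map_GL_invK h t); exact: ulist_map.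
pose F s t := if (size s == a) && `[< dom t >] then H s t else 0.
have Finv h s t : F (map (lmul h) s) (map h t) = F s t.
  rewrite /F size_map i; congr (if _ && _ then _ else _).
  exact: asbool_equiv_eq (dom_map h t).
have bF s t : `|F s t| <= M.
  rewrite /F; case: eqP => [sa|_] /=; last by rewrite normr0.
  by case: asboolP => [[tb ut]|_]; rewrite ?normr0 // bd.
have lF t : lbounded (F^~ t) by move=> n; exists M => s _; exact: bF.
have FE s t : size s = a -> dom t -> F s t = H s t.
  by move=> sa dt; rewrite /F sa eqxx; case: asboolP.
have cF s t : size s = a.+1 -> dom t -> cobd (F^~ t) s = 0.
  move=> sa dt; rewrite -(cl s t sa dt.1 dt.2); apply: eq_cobd_size => u.
  by rewrite sa => -[ua]; exact: FE.
(* two prisms connect [F] with its exchange, which is [- F] *)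
pose Q s t := 2^-1 * (prism (shear_laws (exchange t)) (F^~ (exchange t)) s -
                       prism (swap_laws t) (F^~ t) s).
have QE s t : size s = a -> dom t -> cobd (Q^~ t) s = F s t.
  move=> sa dt; have [chi sc] : exists chi, separates t chi.
    by apply: separates_ex; [exact: dt.2 | rewrite dt.1].
  pose c := mkGL (proj_along (gap t) chi).
  have cE : c =1 proj_along (gap t) chi.
    exact: reflectionE (separates_covec sc) (separates_gap sc).
  have ct : map c t = exchange t by rewrite -(separates_exchange sc); exact: eq_map.
  have dst : dom (exchange t) by exact: dom_perm (perm_exchange t) dt.
  have e1 := av_homotopy (@swap_lawsP t) (lF t) (s := s).
  have e2 := av_homotopy (@shear_lawsP (exchange t)) (lF (exchange t)) (s := s).
  have e3 := av_swap_shear s sc cE (lF (exchange t)).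
  have FT : (fun w => F (map (lmul c) w) (exchange t)) = F^~ t.
    by apply/funext => u; rewrite -ct Finv.
  have Fsw : F s (exchange t) = - F s t.
    by rewrite (FE _ _ sa dst) (FE _ _ sa dt) alternating_exchange // dt.1.
  rewrite cobdZ cobdB.
  rewrite FT in e3; rewrite e3 in e1.
  have e1' := e1 _; have e2' := e2 _.
  have {e1'} := e1' (fun w us => cF w t (etrans us (congr1 S sa)) dt).
  have {e2'} := e2' (fun w us => cF w (exchange t) (etrans us (congr1 S sa)) dst).
  move=> ->; rewrite Fsw => e4.
  have -> : cobd (prism (shear_laws (exchange t)) (F^~ (exchange t))) s -
      cobd (prism (swap_laws t) (F^~ t)) s = F s t + F s t by lra.
  by field.
exists (fun s t => alt (Q s) t).
  split.
  - move=> h s t; rewrite alt_map; apply: eq_alt => u; rewrite /Q; congr (_ * _).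
    rewrite exchange_map (prism_map (h := h) _ _ (nu := shear_laws (exchange u))
      (nu' := shear_laws (map h (exchange u)))); last first.
      by move=> g; exact: shear_laws_map.
    rewrite (prism_map (h := h) _ _ (nu := swap_laws u)); last by move=> g; exact: swap_laws_map.
    congr (_ - _); congr prism; apply/funext => w; exact: Finv.
  - by move=> s; exact: alternating_alt.
  exists (a%:R * M); first exact: mulr_ge0.
  move=> s t sa tb ut; apply: alt_bound => u pu.
  have bP nu t' : (forall g, mean_on (fun=> True) (nu g)) ->
      `|prism nu (F^~ t') s| <= a%:R * M.
    move=> nuP; apply: (le_trans (prism_le nuP M0 _)); first by move=> w _; exact: bF.
    by rewrite ler_wpM2r // ler_nat sa leq_pred.
  rewrite /Q normrM ger0_norm ?invr_ge0 // ler_pdivrMl //.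
  rewrite (le_trans (ler_normB _ _)) //.
  have h1 := bP _ (exchange u) (@shear_lawsP (exchange u)); have h2 := bP _ u (@swap_lawsP u).
  by apply: le_trans (lerD h1 h2) _; rewrite [leRHS]mulrDl mul1r.
move=> s t sa tb ut; have dt : dom t by [].
have -> : cobd (fun s => alt (Q s) t) s = alt (fun t' => cobd (Q^~ t') s) t.
  elim: s Q {QE sa} => [|g s IH] Q.
    by rewrite -[RHS]/(alt (fun=> 0) t) -(mul0r 0) altZ mul0r.
  rewrite cobd_cons (IH (fun s => Q (g :: s))) -altB.
  by apply: eq_alt => u; rewrite cobd_cons.
rewrite -(FE s t) // -[F s t](alt_id (f := F s)); last first.
  move=> s1 x y s2; rewrite /F al.
  have -> : `[< dom (s1 ++ [:: x, y & s2]) >] = `[< dom (s1 ++ [:: y, x & s2]) >].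
    apply: asbool_equiv_eq; split; apply: dom_perm;
      by rewrite perm_cat2l perm_swap.
  by case: ifP; rewrite ?oppr0.
apply/eqP; rewrite -subr_eq0 -altB -normr_le0; apply: alt_bound => u pu.
rewrite QE ?subrr ?normr0 //; apply: dom_perm dt.
by rewrite perm_sym.
Qed.

Lemma invariant_zero b H t : bicochain 0 b H -> (1 < b)%N -> size t = b -> ulist t ->
  H [::] t = 0.
Proof.
move=> [i al _] b2 tb ut.
have [|chi sc] := separates_ex ut; first by rewrite tb.
pose c := mkGL (proj_along (gap t) chi).
have cE : c =1 proj_along (gap t) chi.
  exact: reflectionE (separates_covec sc) (separates_gap sc).
have ct : map c t = exchange t by rewrite -(separates_exchange sc); exact: eq_map.
have := i c [::] t; rewrite /= ct alternating_exchange ?tb //; lra.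
Qed.

(** The double complex argument: [d1 d2 H = 0] says that [d2 H] is closed in its
    column, which is exact since it has at least two vectors; induction along
    the antidiagonal then corrects [H] to a cocycle of its row, which is exact by
    hypothesis.  The induction ends with invariant cochains on partial bases,
    which vanish. *)
Lemma zigzag a b H :
  (forall j, (j <= a + b)%N -> exists2 C : K, 0 <= C & exact_at C (@ulist R N) j) ->
  bicochain a b.+1 H -> (0 < a + b)%N ->
  (forall s t, size s = a.+1 -> size t = b.+2 -> ulist t ->
     cobd (fun s => cobd (H s) t) s = 0) ->
  exists H1 H2, [/\ bicochain a b H1, bicochain a.-1 b.+1 H2 &
    forall s t, size s = a -> size t = b.+1 -> ulist t ->
      H s t = cobd (H1 s) t + cobd (H2^~ t) s].
Proof.
elim: a b H => [|a IH] b H ex bH ab cl.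
  exists (fun _ _ => 0), (fun _ _ => 0); split; try exact: bic_zero.
  move=> s t /size0nil-> tb ut; rewrite cobd0 add0r /cobd /=.
  exact: invariant_zero bH _ tb ut.
have [|||G bG GE] := @column_exact a.+1 b.+2 (fun s t => cobd (H s) t).
- exact: bic_cobd2.
- by [].
- by move=> s t sa tb ut; exact: cl.
have [|||H1 [H2 [b1 b2 GE2]]] := IH b.+1 G _ bG.
- by move=> j jab; apply: ex; lia.
- by rewrite addnS.
- move=> s t sa tb ut; rewrite cobd_comm -[RHS](cobdK (H s) t).
  apply: (eq_cobd_in (@ulist_down_closed R N)) => // u uu.
  by rewrite tb => -[ub]; rewrite -GE.
have [C C0 exC] : exists2 C : K, 0 <= C & exact_at C (@ulist R N) b.+1.
  by apply: ex; lia.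
have [|H' bH' H'E] := row_exact (bic_sub bH (bic_cobd1 b1)) C0 exC.
  move=> s t sa tb ut; rewrite cobdB GE // -cobd_comm.
  apply/eqP; rewrite subr_eq0; apply/eqP.
  have -> : cobd (G^~ t) s = cobd (fun s => cobd (H1 s) t + cobd (H2^~ t) s) s.
    by apply: eq_cobd_size => w; rewrite sa => -[wa]; exact: GE2.
  by rewrite cobdD cobdK addr0.
exists H', H1; split=> // s t sa tb ut.
by rewrite -H'E // subrK.
Qed.

End Vanishing.

(** * The stabilizer of a unimodular vector *)

Section Stabilizer.
Variables (K : realType) (R : pzRingType) (n : nat).
Local Notation G := (GL R (n + 1)).
Local Notation L := (GL R n).
Local Notation incl := (@GL_incl R n).
Implicit Types (g h : G) (l : L).

Definition last_vec : 'cV[R]_(n + 1) := col_mx 0 1%:M.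
Local Notation e := last_vec.

Definition fixes g := g e = e.

Lemma fixes_mul g h : fixes g -> fixes h -> fixes (g * h)%g.
Proof. by rewrite /fixes GL_mulE => fg ->. Qed.

Lemma fixes_inv g : fixes g -> fixes g^-1%g.
Proof. by rewrite /fixes => fg; rewrite -{1}fg GL_invK. Qed.

Lemma fixes_incl l : fixes (incl l).
Proof.
rewrite /fixes /= /GL_incl_fun /last_vec col_mxKu col_mxKd.
have [lD _] := GL_linear l; suff -> : l 0 = 0 by [].
by apply: (addrI (l 0)); rewrite -lD !addr0.
Qed.

Lemma GL_add g (u v : 'cV[R]_(n + 1)) : g (u + v) = g u + g v.
Proof. by have [-> _] := GL_linear g. Qed.

Lemma split_col (v : 'cV[R]_(n + 1)) :
  v = col_mx (usubmx v) 0 + e *m (dsubmx v 0 0)%:M.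
Proof.
rewrite /last_vec mul_col_mx mul0mx mul1mx add_col_mx addr0 add0r.
by rewrite -mx11_scalar vsubmxK.
Qed.

(** On the stabilizer of the last basis vector this is the retraction onto
    [GL_n], with kernel the shears along that vector. *)
Definition corner g : L := mkGL (fun x => usubmx (g (col_mx x 0))).

Lemma cornerE g x : fixes g -> corner g x = usubmx (g (col_mx x 0)).
Proof.
move=> fg; have lin h : right_linear (fun x : 'cV[R]_n => usubmx (h (col_mx x 0)) : 'cV[R]_n) .
  split=> [u v|u a].
    by rewrite -[in LHS](addr0 0) -add_col_mx GL_add raddfD.
  have -> : col_mx (u *m a%:M) 0 = col_mx u 0 *m a%:M :> 'cV[R]_(n + 1).
    by rewrite mul_col_mx mul0mx.
  by rewrite GL_scale; move: (h _) => w; rewrite -[w]vsubmxK mul_col_mx !col_mxKu.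
have can h : fixes h -> cancel (fun x : 'cV[R]_n => usubmx (h (col_mx x 0)) : 'cV[R]_n)
    (fun y => usubmx (h^-1%g (col_mx y 0))).
  move=> fh y /=; set w := h (col_mx y 0).
  have -> : col_mx (usubmx w) 0 = w - e *m (dsubmx w 0 0)%:M.
    by rewrite {2}(split_col w) addrK.
  rewrite GL_sub GL_scale GL_invK (fixes_inv fh) raddfB /= col_mxKu.
  by rewrite /last_vec mul_col_mx mul0mx col_mxKu subr0.
apply: mkGLE; first exact: lin.
exists (fun y => usubmx (g^-1%g (col_mx y 0))); first exact: can.
by have := can _ (fixes_inv fg); rewrite invgK.
Qed.

Lemma fixes_usub g v : fixes g -> usubmx (g v) = corner g (usubmx v).
Proof.
move=> fg; rewrite {1}(split_col v) GL_add GL_scale fg raddfD cornerE //=.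
by rewrite /last_vec mul_col_mx mul0mx col_mxKu addr0.
Qed.

Lemma corner_mul g h : fixes g -> fixes h -> corner (g * h)%g = (corner g * corner h)%g.
Proof.
move=> fg fh; apply: GL_ext => x; rewrite GL_mulE cornerE; last exact: fixes_mul.
by rewrite GL_mulE fixes_usub // -cornerE.
Qed.

Lemma corner_incl l : corner (incl l) = l.
Proof.
apply: GL_ext => x; rewrite cornerE; last exact: fixes_incl.
by rewrite /= /GL_incl_fun col_mxKu col_mxKu.
Qed.

Definition stab_law (f : G -> K) : K :=
  ann_mean [:: e] (fun alpha => f (mkGL (proj_along e alpha))).

Lemma stab_lawP : mean_on (fun=> True) stab_law.
Proof. exact: (mean_push (fun alpha => mkGL (proj_along e alpha)) (ann_meanP _ _)). Qed.

(** An element of the stabilizer differs from its corner by a shear along [e]. *)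
Lemma stab_law_corner g f M : fixes g -> bounded_by M f ->
  stab_law (fun b => f (g * b)%g) = stab_law (fun b => f (incl (corner g) * b)%g).
Proof.
move=> fg bf; pose i := incl (corner g).
have dsub_e : dsubmx e = 1%:M by rewrite /last_vec col_mxKd.
pose beta (v : 'cV[R]_(n + 1)) := dsubmx v 0 0 - dsubmx (g v) 0 0.
have cd : covec (fun v : 'cV[R]_(n + 1) => dsubmx v 0 0).
  split=> [u v|u a]; first by rewrite raddfD mxE.
  by rewrite -{1}[u]vsubmxK mul_col_mx col_mxKd mxE big_ord1 [a%:M _ _]mxE.
have cb : covec beta by apply: covec_sub => //; exact: covec_comp cd (GL_linear g).
have be : beta e = 0 by rewrite /beta fg subrr.
have bA : ann [:: e] beta by split=> // z; rewrite inE => /eqP->.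
pose F alpha := f (i * mkGL (proj_along e alpha))%g.
have bF : bounded_by M F by move=> alpha; exact: bf.
rewrite -[RHS](ann_mean_shift bF bA); apply: (mean_eq (ann_meanP _ _)) => alpha aA.
rewrite /F; congr f; apply: GL_ext => v; rewrite !GL_mulE.
have gE w : g w = i (w - e *m (beta w)%:M).
  rewrite GL_sub GL_scale (fixes_incl _ : i e = e) -[g w]vsubmxK fixes_usub //.
  rewrite -[RHS]vsubmxK; congr col_mx.
    by rewrite raddfB /= /GL_incl_fun col_mxKu /last_vec mul_col_mx mul0mx col_mxKu subr0.
  apply/matrixP => a b; rewrite !ord1.
  rewrite raddfB /= /GL_incl_fun col_mxKd /last_vec mul_col_mx mul1mx col_mxKd.
  have -> (M1 : 'M[R]_1) (c : R) : (M1 - c%:M) 0 0 = M1 0 0 - c.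
    by rewrite !mxE eqxx mulr1n.
  by rewrite /beta subKr.
have a0 : alpha e = 0 by case: aA => _; apply; rewrite inE.
have ab0 : (alpha + beta) e = 0 by rewrite -[LHS]/(alpha e + beta e) a0 be addr0.
rewrite (transvectionE (proj1 aA) a0) (transvectionE (proj1 (annD aA bA)) ab0) gE.
congr (i _); rewrite /proj_along.
have -> : beta (v - e *m (alpha v)%:M) = beta v.
  by rewrite covecB // (proj2 cb) be mul0r subr0.
by rewrite -[(alpha + beta) v]/(alpha v + beta v) scalar_colD opprD addrA.
Qed.

Lemma av_corner (F : seq G -> K) s : lbounded F -> (forall g, g \in s -> fixes g) ->
  av (fun=> stab_law) F s = av (fun=> stab_law) F (map (fun g => incl (corner g)) s).
Proof.
elim: s F => // g s IH F bF fs /=.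
have [M bM] := av_arg_bounded (fun=> stab_lawP) s 1%g bF.
pose f k := av (fun=> stab_law) (slice k F) s.
have bf : bounded_by M f by move=> k; have := bM k; rewrite mul1g.
rewrite (@stab_law_corner g f M) //; last by apply: fs; rewrite mem_head.
congr stab_law; apply/funext => b; apply: IH; first exact: lbounded_slice.
by move=> h hs; apply: fs; rewrite inE hs orbT.
Qed.

Lemma ulist_last : ulist [:: e].
Proof.
apply: (@ulist1 _ _ (rowfun (row_mx 0 1%:M))); first exact: covec_row.
by rewrite /rowfun /last_vec mul_row_col mul0mx mul1mx add0r mxE eqxx.
Qed.

Lemma ulist_image1 g v : ulist [:: v] -> ulist [:: g v].
Proof. exact: (@ulist_map _ _ g [:: v]). Qed.

Section Induction.
Variable sec : 'cV[R]_(n + 1) -> G.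
Hypotheses (secP : forall v, ulist [:: v] -> sec v e = v) (sec1 : sec e = 1%g).

(** Given group elements moving the last basis vector to each vertex, [theta v]
    transports group elements to the stabilizer, compatibly with left
    translations up to the stabilizer.  It implements the Shapiro isomorphism
    between the column of vertices and the cochains of the stabilizer. *)
Definition theta v g : G := ((sec v)^-1 * (g * sec (g^-1%g v)))%g.

Lemma theta_fixes v g : ulist [:: v] -> fixes (theta v g).
Proof.
move=> uv; rewrite /fixes /theta !GL_mulE secP ?GL_Kinv; last exact: ulist_image1.
by have := GL_invK (sec v) e; rewrite secP.
Qed.

Lemma theta_map h v : ulist [:: v] ->
  exists2 c, fixes c & forall g, theta (h v) (lmul h g) = lmul c (theta v g).
Proof.
move=> uv; exists ((sec (h v))^-1 * (h * sec v))%g.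
  rewrite /fixes !GL_mulE secP //.
  have uhv : ulist [:: h v] by exact: ulist_image1.
  by have := GL_invK (sec (h v)) e; rewrite (secP uhv).
move=> g; rewrite /theta /lmul invgM GL_mulE GL_invK.
by rewrite -!mulgA mulVKg.
Qed.

Lemma theta_incl l : theta e (incl l) = incl l.
Proof.
rewrite /theta sec1 invg1 mul1g.
have -> : (incl l)^-1%g e = e by exact/fixes_inv/fixes_incl.
by rewrite sec1 mulg1.
Qed.

Definition induced (w : 'cV[R]_(n + 1) -> seq G -> K) (s : seq G) t : K :=
  if t is [:: v] then (if `[< ulist [:: v] >] then w v s else 0) else 0.

Lemma inducedE w s v : ulist [:: v] -> induced w s [:: v] = w v s.
Proof. by move=> uv /=; case: asboolP. Qed.

Lemma induced_bic a w :
  (forall h s v, ulist [:: v] -> w (h v) (map (lmul h) s) = w v s) ->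
  (exists2 M, 0 <= M & forall v s, size s = a -> `|w v s| <= M) ->
  bicochain a 1 (induced w).
Proof.
move=> wi [M M0 bw]; split.
- move=> h s [|v [|v' t]] //=.
  have -> : `[< ulist [:: h v] >] = `[< ulist [:: v] >].
    apply: asbool_equiv_eq; split=> u; last exact: ulist_image1.
    by have := ulist_image1 (g := h^-1%g) u; rewrite GL_invK.
  by case: asboolP => // uv; exact: wi.
- by move=> s [|x [|? ?]] ? ? ?; rewrite /= ?oppr0.
exists M => // s [|v [|? ?]] //= sa _ uv.
by case: asboolP => // _; exact: bw.
Qed.

End Induction.
End Stabilizer.

(** * Stability for homogeneous cochains *)

Definition gcochain (K : realType) (G : groupType) (a : nat) (F : seq G -> K) :=
  (forall h s, F (map (lmul h) s) = F s) /\
  (exists2 M, 0 <= M & forall s, size s = a -> `|F s| <= M).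

(** Cochains are only controlled on the lists of one length; averaging requires
    bounds on all lists, so they are cut off on the other lengths. *)
Definition clip (K : realType) (G : groupType) (a : nat) (F : seq G -> K) : seq G -> K :=
  fun s => if size s == a then F s else 0.

Section Clip.
Variables (K : realType) (G : groupType) (a : nat) (F : seq G -> K).
Hypothesis gF : gcochain a F.

Lemma clip_size s : size s = a -> clip a F s = F s.
Proof. by rewrite /clip => /eqP->. Qed.

Lemma clip_bound : exists2 M, 0 <= M & forall s, `|clip a F s| <= M.
Proof.
have [_ [M M0 b]] := gF; exists M => // s; rewrite /clip.
by case: eqP => [/b//|_]; rewrite normr0.
Qed.

Lemma clip_lbounded : lbounded (clip a F).
Proof. by have [M _ b] := clip_bound => n; exists M => s _; exact: b. Qed.

Lemma clip_inv h s : clip a F (map (lmul h) s) = clip a F s.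
Proof. by rewrite /clip size_map; case: eqP => // _; have [->] := gF. Qed.

Lemma cobd_clip s : size s = a.+1 -> cobd (clip a F) s = cobd F s.
Proof. by move=> sa; apply: eq_cobd_size => u; rewrite sa => -[]; exact: clip_size. Qed.

End Clip.

Lemma gcochain_prism (K : realType) (G : groupType) a (F : seq G -> K) m :
  mean_on (fun=> True) m -> gcochain a.+1 F -> gcochain a (prism (fun=> m) (clip a.+1 F)).
Proof.
move=> mP gF; split.
  move=> h s; rewrite (prism_map (nu := fun=> m)) //; congr prism.
  by apply/funext => u; exact: clip_inv.
have [M M0 b] := clip_bound gF; exists (a%:R * M); first exact: mulr_ge0.
by move=> s sa; rewrite (le_trans (prism_le (fun=> mP) M0 (fun u _ => b u))) // sa.
Qed.

Section Stability.
Variables (K : realType) (R : pzRingType) (n : nat).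
Local Notation G := (GL R (n + 1)).
Local Notation L := (GL R n).
Local Notation incl := (@GL_incl R n).
Local Notation e := (@last_vec R n).
Implicit Types (g h : G).

(** Splitting off [v] from the whole module exhibits a free complement of [v]. *)
Lemma transitive_unimodular s : (s <= n)%N -> SR R s.+1 ->
  forall v : 'cV[R]_(n + 1), ulist [:: v] -> exists g : G, g e = v.
Proof.
move=> sn srs v uv; have [phi [cp p1 _]] := uv v [::] (perm_refl _).
have [r phiE] := covecP cp.
have rv : r *m v = 1%:M by rewrite [LHS]mx11_scalar -/(rowfun r v) -phiE p1.
have BC : (1%:M : 'M[R]_(n + 1)) *m 1%:M = 1%:M by rewrite mul1mx.
have [D [C2 [psi [CD psiD psiv ker]]]] := split_off srs sn BC rv.
rewrite !mul1mx in CD psiD ker.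
pose P : 'M[R]_(n + 1) := row_mx D v.
pose Q : 'M[R]_(n + 1) := col_mx (C2 *m (1%:M - v *m psi)) psi.
have PK : cancel (mulmx P : 'cV[R]_(n + 1) -> 'cV[R]_(n + 1)) (mulmx Q).
  move=> x; rewrite mulmxA /P /Q mul_col_row psiD psiv.
  have -> : C2 *m (1%:M - v *m psi) *m D = 1%:M.
    by rewrite -mulmxA mulmxBl mul1mx -mulmxA psiD mulmx0 subr0.
  have -> : C2 *m (1%:M - v *m psi) *m v = 0.
    by rewrite -mulmxA mulmxBl mul1mx -mulmxA psiv mulmx1 subrr mulmx0.
  by rewrite -scalar_mx_block mul1mx.
have QK : cancel (mulmx Q : 'cV[R]_(n + 1) -> 'cV[R]_(n + 1)) (mulmx P).
  move=> x; rewrite /P /Q mul_col_mx mul_row_col.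
  have := ker (x - v *m (psi *m x)); rewrite !mul1mx => kerx.
  rewrite -!mulmxA [(_ - _) *m x]mulmxBl mul1mx -[_ *m psi *m x]mulmxA kerx ?subrK //.
  by rewrite mulmxBr (mulmxA psi) psiv mul1mx subrr.
have lin : right_linear (mulmx P : 'cV[R]_(n + 1) -> 'cV[R]_(n + 1)).
  by split=> [x y|x a]; rewrite ?mulmxDr ?mulmxA.
exists (MkGL lin (Bijective PK QK)) => /=.
by rewrite /P /last_vec mul_row_col mulmx0 add0r mulmx1.
Qed.

Hypothesis trans : forall v : 'cV[R]_(n + 1), ulist [:: v] -> exists g : G, g e = v.

Lemma section_ex : exists sec : 'cV[R]_(n + 1) -> G,
  (forall v, ulist [:: v] -> sec v e = v) /\ sec e = 1%g.
Proof.
have /choice[f fP] v : exists g : G, ulist [:: v] -> g e = v.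
  by have [/trans[g ge]|nu] := pselect (ulist [:: v]); [exists g | exists 1%g].
exists (fun v => if v == e then 1%g else f v); split; last by rewrite eqxx.
by move=> v uv; case: eqP => [->//|_]; exact: fP.
Qed.

Lemma cobd_const2 (A : Type) (c : K) (t : seq A) : size t = 2%N -> cobd (fun=> c) t = 0.
Proof. by case: t => [|x [|y []]] // _; rewrite /cobd /= subr0 subrr. Qed.

Definition exact_upto q := forall j, (j <= q)%N ->
  exists2 C : K, 0 <= C & exact_at C (@ulist R (n + 1)) j.

(** Averaging over the abelian kernel of the corner map makes a cochain on the
    stabilizer depend on corners only, so a cochain that bounds on the corner
    group bounds on the stabilizer. *)
Lemma bounds_on_stabilizer q (F : seq G -> K) (u : seq L -> K) :
  gcochain q.+1 F -> gcochain q u ->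
  (forall s, size s = q.+2 -> cobd F s = 0) ->
  (forall l, size l = q.+1 -> F (map incl l) = cobd u l) ->
  exists w : seq G -> K, [/\
    forall c s, fixes c -> (forall g, g \in s -> fixes g) -> w (map (lmul c) s) = w s,
    exists2 M, 0 <= M & forall s, size s = q -> `|w s| <= M &
    forall s, size s = q.+1 -> (forall g, g \in s -> fixes g) -> clip q.+1 F s = cobd w s].
Proof.
move=> gF gu cF uF; set F1 := clip q.+1 F.
have bF1 : lbounded F1 by exact: clip_lbounded.
set m := @stab_law K R n; have mP : mean_on (fun=> True) m by exact: stab_lawP.
set PF := prism (fun=> m) F1.
have [Pi [MP MP0 Pb]] : gcochain q PF by exact: gcochain_prism.
have [ui [Mu Mu0 ub]] := gu.
have avE s : size s = q.+1 -> av (fun=> m) F1 s = F1 s + cobd PF s.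
  move=> sq; apply: av_homotopy => // w; rewrite sq => wq.
  by rewrite cobd_clip ?cF.
(* [z] bounds the average of [F] on [L] *)
pose z l := u l + PF (map incl l).
exists (fun s => z (map (@corner R n) s) - PF s); split.
- move=> c s fc fs; rewrite Pi; congr (_ - _).
  have -> : map (@corner R n) (map (lmul c) s) = map (lmul (corner c)) (map (@corner R n) s).
    rewrite -!map_comp; apply/eq_in_map => g gs /=.
    by rewrite /lmul corner_mul //; exact: fs.
  rewrite /z ui; congr (_ + _).
  have -> : map incl (map (lmul (corner c)) (map (@corner R n) s)) =
      map (lmul (incl (corner c))) (map incl (map (@corner R n) s)).
    by rewrite -!map_comp; apply: eq_map => g /=; rewrite /lmul GL_inclM.
  exact: Pi.
- exists ((Mu + MP) + MP); first by rewrite !addr_ge0.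
  move=> s sq; rewrite (le_trans (ler_normB _ _)) // lerD ?Pb //.
  by rewrite (le_trans (ler_normD _ _)) // lerD ?ub ?Pb // !size_map.
move=> s sq fs; rewrite cobdB -cobd_map cobdD -cobd_map -uF ?size_map //.
have sq' : size (map incl (map (@corner R n) s)) = q.+1 by rewrite !size_map.
rewrite -(clip_size F sq') -/F1 -(avE _ sq').
have -> : map incl (map (@corner R n) s) = map (fun g => incl (corner g)) s.
  by rewrite -map_comp.
by rewrite -av_corner // avE // addrK.
Qed.

(** A class that dies on [GL_n] dies on the stabilizer of the last basis vector by
    [bounds_on_stabilizer], hence after pulling back to the column of vertices;
    a primitive there is moved to the column without vectors by [zigzag]. *)
Lemma restriction_injective q (F : seq G -> K) (u : seq L -> K) : (0 < q)%N ->
  exact_upto q -> gcochain q.+1 F -> gcochain q u ->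
  (forall s, size s = q.+2 -> cobd F s = 0) ->
  (forall l, size l = q.+1 -> F (map incl l) = cobd u l) ->
  exists2 F', gcochain q F' & forall s, size s = q.+1 -> F s = cobd F' s.
Proof.
move=> q0 ex gF gu cF uF.
have [w [wi [Mw Mw0 wb] wE]] := bounds_on_stabilizer gF gu cF uF.
have [sec [secP sec1]] := section_ex.
set F1 := clip q.+1 F in wE.
have bF1 : lbounded F1 by exact: clip_lbounded.
have [M M0 F1b] := clip_bound gF.
pose nu v g : (G -> K) -> K := dirac (sec (g^-1%g v)).
have nuP v g : mean_on (fun=> True) (nu v g) by exact: dirac_mean.
(* [w] bounds [F] after the entries are multiplied on the right by values of the
   section, and the prism undoes these multiplications *)
pose W v s := w (map (theta sec v) s) - prism (nu v) F1 s.
have WE v s : ulist [:: v] -> size s = q.+1 -> cobd (W v) s = F1 s.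
  move=> uv sq; rewrite cobdB -cobd_map -wE ?size_map //; last first.
    by move=> _ /mapP[g _ ->]; exact: theta_fixes.
  have -> : F1 (map (theta sec v) s) = av (nu v) F1 s.
    rewrite av_dirac -[RHS](clip_inv gF (sec v)^-1%g) -map_comp.
    by congr F1; apply: eq_map => g.
  rewrite (av_homotopy (nuP v)) ?addrK // => k; rewrite sq => kq.
  by rewrite cobd_clip ?cF.
have bW : bicochain q 1 (induced W).
  apply: induced_bic.
    move=> h s v uv; rewrite /W; congr (_ - _).
      have [c fc cE] := theta_map secP h uv.
      have -> : map (theta sec (h v)) (map (lmul h) s) = map (lmul c) (map (theta sec v) s).
        by rewrite -!map_comp; apply: eq_map => g; exact: cE.
      by apply: wi => // _ /mapP[g _ ->]; exact: theta_fixes.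
    rewrite (prism_map (nu := nu v)); last first.
      by move=> g; rewrite /nu /lmul invgM GL_mulE GL_invK.
    by congr prism; apply/funext => k; exact: clip_inv.
  exists (Mw + q%:R * M); first by rewrite addr_ge0 // mulr_ge0.
  move=> v s sq; rewrite (le_trans (ler_normB _ _)) // lerD //.
    by rewrite wb // size_map.
  by rewrite -sq; apply: prism_le => // k _; exact: F1b.
have cW s t : size s = q.+1 -> size t = 1%N -> ulist t -> cobd ((induced W)^~ t) s = F1 s.
  move=> sq; case: t => [|v []] // _ uv; rewrite -(WE v s uv sq).
  by apply: eq_cobd => k; exact: inducedE.
have [|||H1 [H2 [b1 _ HE]]] := @zigzag K R (n + 1) q 0 (induced W) _ bW.
- by move=> j; rewrite addn0; exact: ex.
- by rewrite addn0.
- move=> s t sq t2 ut; rewrite cobd_comm -(@cobd_const2 _ (F1 s) t) //.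
  apply: (eq_cobd_in (@ulist_down_closed R (n + 1))) => // k uk.
  by rewrite t2 => -[kk]; exact: cW.
exists (H1^~ [::]).
  have [i _ [M' M'0 b]] := b1; split; first by move=> h s; rewrite -(i h s [::]).
  exists M' => // s sq; apply: b => //.
  by move=> x r /perm_size.
move=> s sq; rewrite -(clip_size F sq) -/F1 -(cW s [:: e]) //; last exact: ulist_last.
have -> : cobd ((induced W)^~ [:: e]) s =
    cobd (fun k => H1 k [::] + cobd (H2^~ [:: e]) k) s.
  apply: eq_cobd_size => k; rewrite sq => -[kq]; rewrite HE //; last exact: ulist_last.
  by congr (_ + _); rewrite /cobd /= subr0.
by rewrite cobdD cobdK addr0.
Qed.

(** Inducing along [theta] extends a cocycle of [GL_n] to the column of vertices,
    where it is cohomologous to one that does not depend on the vertex. *)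
Lemma restriction_surjective q (f : seq L -> K) :
  exact_upto q.+1 -> gcochain q.+1 f ->
  (forall l, size l = q.+2 -> cobd f l = 0) ->
  exists F u, [/\ gcochain q.+1 F, gcochain q u,
    forall s, size s = q.+2 -> cobd F s = 0 &
    forall l, size l = q.+1 -> f l = F (map incl l) + cobd u l].
Proof.
move=> ex [fi [M M0 fb]] cf.
have [sec [secP sec1]] := section_ex.
pose W v s := f (map (fun g => corner (theta sec v g)) s).
have bW : bicochain q.+1 1 (induced W).
  apply: induced_bic.
    move=> h s v uv; have [c fc cE] := theta_map secP h uv.
    rewrite /W -map_comp.
    rewrite -[RHS](fi (corner c)) -map_comp; congr f; apply: eq_map => g /=.
    rewrite cE /lmul corner_mul //; exact: theta_fixes.
  by exists M => // v s sq; rewrite /W fb // size_map.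
have cW s t : size s = q.+2 -> size t = 1%N -> ulist t -> cobd ((induced W)^~ t) s = 0.
  move=> sq; case: t => [|v []] // _ uv.
  have -> : cobd ((induced W)^~ [:: v]) s = cobd (W v) s.
    by apply: eq_cobd => k; exact: inducedE.
  by rewrite /W -cobd_map cf // size_map.
have [|||H1 [H2 [b1 b2 HE]]] := @zigzag K R (n + 1) q.+1 0 (induced W) _ bW.
- by move=> j; rewrite addn0; exact: ex.
- by [].
- move=> s t sq t2 ut; rewrite cobd_comm -(@cobd_const2 _ 0 t) //.
  apply: (eq_cobd_in (@ulist_down_closed R (n + 1))) => // k uk.
  by rewrite t2 => -[kk]; exact: cW.
have ue := @ulist_last R n.
have HE' k : size k = q.+1 ->
    induced W k [:: e] = H1 k [::] + cobd (H2^~ [:: e]) k.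
  by move=> kq; rewrite HE //; congr (_ + _); rewrite /cobd /= subr0.
have fixL (l : L) (k : seq L) : map (lmul (incl l)) (map incl k) = map incl (map (lmul l) k).
  by rewrite -!map_comp; apply: eq_map => x /=; rewrite /lmul GL_inclM.
exists (H1^~ [::]), (fun k => H2 (map incl k) [:: e]); split.
- have [i _ [M' M'0 b]] := b1; split; first by move=> h s; rewrite -(i h s [::]).
  exists M' => // s sq; apply: b => //.
  by move=> x r /perm_size.
- have [i _ [M' M'0 b]] := b2; split.
    move=> l k; rewrite -fixL -[RHS](i (incl l)); congr (H2 _ [:: _]).
    by rewrite (fixes_incl l).
  by exists M' => // s sq; apply: b => //; rewrite size_map.
- move=> s sq; rewrite -[RHS](cW s [:: e]) //.
  have -> : cobd ((induced W)^~ [:: e]) s =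
      cobd (fun k => H1 k [::] + cobd (H2^~ [:: e]) k) s.
    by apply: eq_cobd_size => k; rewrite sq => -[kq]; exact: HE'.
  by rewrite cobdD cobdK addr0.
move=> l lq; rewrite -(cobd_map incl (H2^~ [:: e]) l).
rewrite -HE' ?size_map // inducedE // /W -map_comp.
congr f; rewrite -[LHS]map_id; apply: eq_map => x /=.
by rewrite theta_incl // corner_incl.
Qed.

End Stability.

(** * Homogeneous and inhomogeneous cochains *)

Section Homogeneous.
Variables (K : realType) (G : groupType).
Implicit Types (s : seq G) (F : seq G -> K).

Definition ratios q s : 'I_q -> G :=
  fun i => ((nth 1%g s i)^-1 * nth 1%g s i.+1)%g.

(** Cut off at lists of one length, because the default value of [nth] would
    break invariance on shorter ones. *)
Definition homogeneous q (c : ('I_q -> G) -> K) : seq G -> K :=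
  clip q.+1 (fun s => c (@ratios q s)).

Fixpoint partial_product q (g : 'I_q -> G) (i : nat) : G :=
  if i is j.+1 then
    (partial_product g j * (if insub j is Some k then g k else 1))%g
  else 1%g.

Definition partial_products q (g : 'I_q -> G) : seq G :=
  mkseq (partial_product g) q.+1.

Lemma size_partial_products q (g : 'I_q -> G) : size (partial_products g) = q.+1.
Proof. exact: size_mkseq. Qed.

Lemma ratios_partial_products q (g : 'I_q -> G) : ratios (partial_products g) = g.
Proof.
apply/funext => i; have iq := ltn_ord i.
rewrite /ratios !nth_mkseq //; last exact: ltnW.
by rewrite /= insubT /= mulKg; congr g; apply: val_inj.
Qed.

Lemma partial_products_ratios q s : size s = q.+1 ->
  partial_products (@ratios q s) = map (lmul (nth 1%g s 0)^-1%g) s.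
Proof.
move=> sq; apply: (@eq_from_nth _ 1%g).
  by rewrite size_partial_products size_map.
move=> i; rewrite size_partial_products => iq.
rewrite nth_mkseq // (nth_map 1%g) ?sq // /lmul.
elim: i iq => [|i IH] iq /=; first by rewrite mulVg.
by rewrite IH ?(ltnW iq) // insubT /ratios /= -mulgA mulVKg.
Qed.

Lemma homogeneous_partial_products q F s : size s = q.+1 ->
  (forall h s, F (map (lmul h) s) = F s) ->
  homogeneous (fun g : 'I_q -> G => F (partial_products g)) s = F s.
Proof. by move=> sq i; rewrite /homogeneous clip_size // partial_products_ratios. Qed.

Lemma nth_del s i j : (i < size s)%N ->
  nth 1%g (take i s ++ drop i.+1 s) j = nth 1%g s (if (j < i)%N then j else j.+1).
Proof.
move=> lis; rewrite nth_cat size_take lis; case: ltnP => ji.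
  by rewrite nth_take.
by rewrite nth_drop; congr nth; lia.
Qed.

Lemma ratios_del q s i : size s = q.+2 -> (i < q.+2)%N ->
  @ratios q (take i s ++ drop i.+1 s) = nerve_face i (@ratios q.+1 s).
Proof.
move=> sq iq; apply/funext => j; rewrite /ratios /nerve_face !nth_del ?sq //=.
rewrite /bump /= add1n.
by case: (ltngtP j.+1 i) => // _; rewrite -mulgA mulVKg.
Qed.

Lemma cobd_homogeneous q (f : bcochain K G q) s : size s = q.+2 ->
  cobd (homogeneous f) s = homogeneous (bar_diff f) s.
Proof.
move=> sq; rewrite cobdE [RHS]clip_size // sq; apply: eq_bigr => i _; congr (_ * _).
rewrite /homogeneous clip_size ?ratios_del //.
by apply: succn_inj; rewrite size_del ?sq.
Qed.

Lemma gcochain_homogeneous q (f : bcochain K G q) : gcochain q.+1 (homogeneous f).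
Proof.
split=> [h s|]; last first.
  have [M M0 b] := bcochainP f; exists M => // s sq.
  by rewrite /homogeneous clip_size //; exact: b.
rewrite /homogeneous /clip size_map; case: eqP => // sq; congr (f _).
apply/funext => i; have iq := ltn_ord i.
have [i1 i2] : (i < size s)%N /\ (i.+1 < size s)%N by rewrite sq; split; lia.
rewrite /ratios !(nth_map 1%g) //.
by rewrite /lmul invgM -mulgA mulKg.
Qed.

Lemma bcochain_of_subproof q F : gcochain q.+1 F ->
  (fun g : 'I_q -> G => F (partial_products g)) \in @bounded_cochain K G q.
Proof.
move=> [_ [M _ b]]; rewrite inE; exists M => g; apply: b.
exact: size_partial_products.
Qed.

Definition bcochain_of q F (gF : gcochain q.+1 F) : bcochain K G q :=
  BCochain (bcochain_of_subproof gF).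

Lemma homogeneous_bcochain_of q F (gF : gcochain q.+1 F) s : size s = q.+1 ->
  homogeneous (bcochain_of gF) s = F s.
Proof. by move=> sq; apply: homogeneous_partial_products => //; case: gF. Qed.

Lemma homogeneous_inj q (f f' : bcochain K G q) :
  (forall s, size s = q.+1 -> homogeneous f s = homogeneous f' s) -> f = f'.
Proof.
move=> e; apply: val_inj; apply/funext => g /=.
have := e (partial_products g) (size_partial_products g).
by rewrite /homogeneous !clip_size ?size_partial_products // ratios_partial_products.
Qed.

Lemma homogeneousB q (f f' : bcochain K G q) s :
  homogeneous (f - f') s = homogeneous f s - homogeneous f' s.
Proof. by rewrite /homogeneous /clip; case: eqP => //; rewrite subr0. Qed.

Lemma homogeneous0 q s : homogeneous (0 : bcochain K G q) s = 0.
Proof. by rewrite /homogeneous /clip; case: eqP. Qed.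

End Homogeneous.

Lemma homogeneous_pullback (K : realType) (G G' : groupType)
    (phi : {multiplicative G -> G'}) q (f : bcochain K G' q) s :
  homogeneous (bar_pullback phi f) s = homogeneous f (map phi s).
Proof.
rewrite /homogeneous /clip size_map; case: eqP => // sq.
rewrite /= ; congr (f _); apply/funext => i /=; have iq := ltn_ord i.
have [i1 i2] : (i < size s)%N /\ (i.+1 < size s)%N by rewrite sq; split; lia.
rewrite /ratios !(nth_map 1%g) //.
by apply: (mulgI (phi (nth 1%g s i))); rewrite -gmulfM !mulVKg.
Qed.

Section Classes.
Variables (K : realType) (C : cochain_complex K) (q : nat).

Lemma coh_class0 (z : cocycles C q) : coh_class z = 0 <-> is_coboundary (cocycle_val z).
Proof.
have e0 : coh_class (0 *: z) = 0 by rewrite coh_classZ scale0r.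
rewrite -e0 scale0r; split=> [/coh_class_eq|h].
  by rewrite subr0 inE.
by apply/coh_class_eq; rewrite subr0 inE.
Qed.

End Classes.

Section Restriction.
Variables (K : realType) (R : pzRingType) (n s : nat).
Hypotheses (s_gt0 : (0 < s)%N) (srs : SR R s.+1).
Local Notation G := (GL R (n + 1)).
Local Notation L := (GL R n).
Local Notation incl := (@GL_incl R n).
Local Notation res q := (bounded_cohomology_map K incl q).

Lemma exact_upto_GL q : (s + (2 * q - 1) <= n + 1)%N -> exact_upto K R n q.
Proof.
move=> le j jq; have [|C C0 ex] := @unimodular_exact K R s s_gt0 srs (n + 1) (n + 1) 0 j.
  by lia.
exists C => //; have := ex 1%:M 1%:M [::] (mul1mx _) _ erefl.
move=> ex1; apply: (exact_at_iff _ (ex1 _)).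
  move=> t; rewrite /link_in cats0; split=> [[]//|ut]; split=> //.
  by apply/allP => x _; apply/asboolP; exists x; rewrite mul1mx.
by move=> x r /perm_size.
Qed.

Lemma restriction_inj0 : injective (res 0).
Proof.
apply: raddf_inj => x; have [z ->] := coh_classP x.
rewrite /= cohomology_map_class => /coh_class0 /= z0; apply/coh_class0 => /=.
have z1 := congr1 (fun c : bcochain K L 0 => bcochain_val c (fun=> 1%g)) z0.
apply: val_inj; apply/funext => g.
transitivity (bcochain_val (cocycle_val z) (incl \o (fun=> 1%g))); last exact: z1.
by rewrite /=; congr (bcochain_val (cocycle_val z) _); apply/funext => -[].
Qed.

Lemma cocycle_closed (H : groupType) q (z : cocycles (bounded_bar K H) q) t :
  size t = q.+2 -> cobd (homogeneous (cocycle_val z)) t = 0.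
Proof.
move=> tq; rewrite cobd_homogeneous //.
have -> : bar_diff (cocycle_val z) = 0 by apply/eqP; exact: (valP z).
exact: homogeneous0.
Qed.

Lemma restriction_inj q : (s + 2 * q <= n + 2)%N -> injective (res q).
Proof.
case: q => [|q] le; first exact: restriction_inj0.
apply: raddf_inj => x; have [z ->] := coh_classP x.
rewrite /= cohomology_map_class => /coh_class0 /= [y zy].
have tr : forall v : 'cV[R]_(n + 1), ulist [:: v] -> exists g : G, g (last_vec R n) = v.
  by apply: (@transitive_unimodular R n s) => //; lia.
have ex : exact_upto K R n q.+1 by apply: exact_upto_GL; lia.
have [|F gF FE] := restriction_injective tr (ltn0Sn q) ex
  (gcochain_homogeneous (cocycle_val z)) (gcochain_homogeneous y) (@cocycle_closed _ _ z).
  move=> l lq; rewrite cobd_homogeneous // -[bar_diff y]zy.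
  by rewrite -homogeneous_pullback.
apply/coh_class0; exists (bcochain_of gF); apply: homogeneous_inj => t tq.
rewrite FE // -cobd_homogeneous //; apply: eq_cobd_size => u.
by rewrite tq => -[uq]; rewrite homogeneous_bcochain_of.
Qed.

Lemma restriction_surj0 x : exists y, res 0 y = x.
Proof.
have [z ->] := coh_classP x.
have cb : (fun=> cocycle_val z (fun=> 1%g)) \in @bounded_cochain K G 0.
  by rewrite inE; exists `|cocycle_val z (fun=> 1%g)|.
pose c : bounded_bar K G 0 := BCochain cb.
have cc : c \in @cocycle K (bounded_bar K G) 0.
  have e0 : bar_diff (BCochain cb) = 0; last by apply/eqP; exact: e0.
  apply: val_inj; apply/funext => g.
  rewrite [LHS]/= /bar_diff_fun big_ord_recl big_ord1 /= expr0 expr1 mul1r mulN1r.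
  exact: subrr.
exists (coh_class (Cocycle cc)); rewrite /= cohomology_map_class; congr coh_class.
apply: val_inj; apply: val_inj; apply/funext => g /=.
by congr (bcochain_val (cocycle_val z) _); apply/funext => -[].
Qed.

Lemma restriction_surj q : (s + 2 * q <= n)%N -> forall x, exists y, res q y = x.
Proof.
case: q => [_|q le x]; first exact: restriction_surj0.
have [z ->] := coh_classP x.
have tr : forall v : 'cV[R]_(n + 1), ulist [:: v] -> exists g : G, g (last_vec R n) = v.
  by apply: (@transitive_unimodular R n s) => //; lia.
have ex : exact_upto K R n q.+2 by apply: exact_upto_GL; lia.
have [F [u [gF gu cF fE]]] := restriction_surjective tr ex
  (gcochain_homogeneous (cocycle_val z)) (@cocycle_closed _ _ z).
pose c : bounded_bar K G q.+1 := bcochain_of gF.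
have cc : c \in @cocycle K (bounded_bar K G) q.+1.
  apply/eqP; apply: homogeneous_inj => t tq.
  rewrite homogeneous0 -[LHS]cobd_homogeneous // -(cF t tq); apply: eq_cobd_size => w.
  by rewrite tq => -[wq]; rewrite homogeneous_bcochain_of.
exists (coh_class (Cocycle cc)); rewrite /= cohomology_map_class.
apply/esym/coh_class_eq; rewrite inE /=.
exists (bcochain_of gu); apply: homogeneous_inj => t tq.
rewrite -[in RHS]cobd_homogeneous //.
have -> : cobd (homogeneous (bcochain_of gu)) t = cobd u t.
  by apply: eq_cobd_size => w; rewrite tq => -[wq]; rewrite homogeneous_bcochain_of.
rewrite homogeneousB fE // homogeneous_pullback homogeneous_bcochain_of ?size_map //.
by rewrite addrAC subrr add0r.
Qed.

End Restriction.

Lemma stable_rankP (R : pzRingType) : stable_rank R = +oo%E \/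
  exists s, [/\ stable_rank R = s%:R%:E, (0 < s)%N & SR R s.+1].
Proof.
rewrite /stable_rank; case: pselect => [ex|_]; last by left.
by right; case: ex_minnP => s /andP[s0 /asboolP srs] _; exists s.
Qed.

Theorem theoremB (K : realType) (R : pzRingType) (n q : nat) :
  ((q%:R%:E <= (n%:R%:E - stable_rank R) * (2^-1)%:E)%E ->
     bijective (bounded_cohomology_map K (@GL_incl R n) q)) /\
  ((q%:R%:E <= (n%:R%:E - stable_rank R) * (2^-1)%:E + 1%:E)%E ->
     injective (bounded_cohomology_map K (@GL_incl R n) q)).
Proof.
have [->|[s [-> s0 srs]]] := stable_rankP R.
  rewrite addeNy gt0_mulNye ?lte_fin ?invr_gt0 //.
rewrite -EFinB -EFinM -EFinD !lee_fin; split=> le.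
  have le' : (s + 2 * q <= n)%N by rewrite -(ler_nat rat) natrD natrM; lra.
  have inj : injective (bounded_cohomology_map K (@GL_incl R n) q).
    by apply: (@restriction_inj K R n s) => //; lia.
  have [f fK] := choice (@restriction_surj K R n s s0 srs q le').
  by exists f => // y; apply: inj; rewrite fK.
apply: (@restriction_inj K R n s) => //.
by rewrite -(ler_nat rat) (natrD _ s) natrM natrD; lra.
Qed.
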